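(* Let $\Phi$ be a ternary quadratic form with integer coefficients, isotropic over $\mathbb{Q}$, with discriminant $\Delta_\Phi>0$, and let $\mathcal{C}=\{\Phi=0\}\subset\mathbb{P}^2$ be the associated conic (so $\mathcal{C}$ is a conic over $\mathbb{Q}$ having a $\mathbb{Q}$-point). Then there exist integers $n$ and $m$, with $nm^2\mid \Delta_\Phi$, and a parametrization $\mathcal{C}\cong\mathbb{P}^1$ (an isomorphism of curves over $\mathbb{Q}$) such that for any irrational points $[\Xi],[\Xi']\in\mathcal{C}(\mathbb{R})$ (distinct, in the formulas for $\mu$), with corresponding coordinates $\xi,\xi'\in\mathbb{R}$ under the parametrization, $$\lambda([\Xi]) = m\cdot\max_{d\mid n}\lambda(d\xi) = m\cdot\limsup_{\frac{s}{t}\in\mathbb{Q},\ \frac{s}{t}\to\xi}\frac{\gcd(t,n)}{t^2\left|\frac{s}{t}-\xi\right|},$$ $$\mu([\Xi],[\Xi']) = m\cdot\max_{d\mid n}\mu(d\xi,d\xi') = m\cdot\sup_{(s,t)\in\mathbb{Z}^2\setminus\{0\}}\frac{|\xi-\xi'|\cdot\gcd(t,n)}{t^2\left|\frac{s}{t}-\xi\right|\left|\frac{s}{t}-\xi'\right|}.$$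
   Context: For an integer ternary quadratic form $\Phi(X,Y,Z)=AX^2+BXY+CY^2+DXZ+EYZ+FZ^2$, the discriminant is $\Delta_\Phi=4\det\begin{bmatrix}A&B/2&D/2\\ B/2&C&E/2\\ D/2&E/2&F\end{bmatrix}$, and the bilinear form is $\langle P,Q\rangle_\Phi=\frac{1}{2}(\Phi(P+Q)-\Phi(P)-\Phi(Q))$. $\Phi$ is isotropic over $\mathbb{Q}$ if $\Phi(P)=0$ for some $P\in\mathbb{Q}^3\setminus\{0\}$. For a nonzero vector $P$, $[P]$ denotes the corresponding projective point. When $\Phi$ is isotropic and $\Delta_\Phi>0$, $\Phi$ has signature $(1,2)$. $\mathcal{C}(\mathbb{Z})$ denotes the set of primitive vectors $P\in\mathbb{Z}^3$ with $\Phi(P)=0$ (rational points of $\mathcal{C}$ written in lowest terms). Approximability of a pair on $\mathcal{C}$: for distinct $[\Xi],[\Xi']\in\mathcal{C}(\mathbb{R})$, let $[\Sigma]\in\mathbb{P}^2(\mathbb{R})$ be the intersection of the tangent lines to $\mathcal{C}$ at $[\Xi]$ and $[\Xi']$ (so $\Phi(\Sigma)<0$); then $$\mu([\Xi],[\Xi'])=\sup_{P\in\mathcal{C}(\mathbb{Z})}\frac{\sqrt{\Delta_\Phi|\Phi(\Sigma)|}}{|\langle\Sigma,P\rangle_\Phi|}\in\mathbb{R}\cup\{\infty\}.$$ Approximability of a point on $\mathcal{C}$: for $[\Xi]\in\mathcal{C}(\mathbb{R})$, let $[\Sigma]\ne[\Xi]$ be any real point on the tangent line to $\mathcal{C}$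 at $[\Xi]$; then $$\lambda([\Xi])=\limsup_{P\in\mathcal{C}(\mathbb{Z}),\ [P]\to[\Xi]}\frac{\sqrt{\Delta_\Phi|\Phi(\Sigma)|}}{|\langle\Sigma,P\rangle_\Phi|}\in\mathbb{R}\cup\{\infty\}$$ (this does not depend on the choice of $\Sigma$). Approximability of irrational real numbers $\xi\neq\xi'$: $$\lambda(\xi)=\limsup_{\frac{s}{t}\in\mathbb{Q},\ \frac{s}{t}\to\xi}\frac{1}{t^2\left|\frac{s}{t}-\xi\right|},\qquad \mu(\xi,\xi')=\sup_{(s,t)\in\mathbb{Z}^2\setminus\{0\}}\frac{|\xi-\xi'|}{t^2\left|\frac{s}{t}-\xi\right|\left|\frac{s}{t}-\xi'\right|}.$$ Rational numbers $s/t$ in a limsup are written in lowest terms; expressions $t^2|\frac{s}{t}-\xi||\frac{s}{t}-\xi'|$ are read as $|s-t\xi||s-t\xi'|$, so that $t=0$ is allowed, and $\gcd(0,n)=|n|$. In $\max_{d\mid n}$, $d$ runs over positive divisors of $n$. An irrational point of $\mathcal{C}(\mathbb{R})$ is one not in $\mathcal{C}(\mathbb{Q})$. The coordinate of a point of $\mathbb{P}^1$ is $\xi$ for $[\xi:1]$. *)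

(* Defs.v *)
From HB Require Import structures.
From mathcomp Require Import all_boot all_order all_algebra.
From mathcomp Require Import complex.
(* The notations of mpoly are incompatible with those of mathcomp-analysis. *)
From mathcomp Require Import -(notations) mpoly.
From mathcomp Require Import all_classical all_reals all_analysis.

Set Implicit Arguments.
Unset Strict Implicit.
Unset Printing Implicit Defensive.

Import Order.TTheory GRing.Theory Num.Theory numFieldNormedType.Exports.

Local Open Scope classical_set_scope.
Local Open Scope ring_scope.

(* A X^2 + B XY + C Y^2 + D XZ + E YZ + F Z^2 *)
Record tqf := Tqf {
  cA : int; cB : int; cC : int; cD : int; cE : int; cF : int }.

Definition qval (K : comNzRingType) (Phi : tqf) (v : 'rV[K]_3) : K :=
  let x := v 0 0 in let y := v 0 1 in let z := v 0 2 in
  (cA Phi)%:~R * x ^+ 2 + (cB Phi)%:~R * x * y + (cC Phi)%:~R * y ^+ 2 +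
  (cD Phi)%:~R * x * z + (cE Phi)%:~R * y * z + (cF Phi)%:~R * z ^+ 2.

Definition qbil (K : fieldType) (Phi : tqf) (P Q : 'rV[K]_3) : K :=
  2^-1 * (qval Phi (P + Q) - qval Phi P - qval Phi Q).

Definition qmatrix (K : fieldType) (Phi : tqf) : 'M[K]_3 :=
  let a : K := (cA Phi)%:~R in let b : K := (cB Phi)%:~R in
  let c : K := (cC Phi)%:~R in let d : K := (cD Phi)%:~R in
  let e : K := (cE Phi)%:~R in let f : K := (cF Phi)%:~R in
  \matrix_(i < 3, j < 3)
    nth 0 (nth [::] [:: [:: a;     b / 2; d / 2];
                        [:: b / 2; c;     e / 2];
                        [:: d / 2; e / 2; f    ]] i) j.

Definition disc (K : fieldType) (Phi : tqf) : K := 4 * \det (qmatrix K Phi).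

Definition isotropic (Phi : tqf) : Prop :=
  exists2 P : 'rV[rat]_3, P != 0 & qval Phi P = 0.

(* Points of projective space are represented by nonzero row vectors, and
   equality of points by proportionality. *)
Definition proj_eq (K : fieldType) (n : nat) (u v : 'rV[K]_n) : Prop :=
  exists2 c : K, c != 0 & u = c *: v.

(* The affine cone over the conic; its nonzero vectors represent the K-points. *)
Definition conic (K : comNzRingType) (Phi : tqf) : set 'rV[K]_3 :=
  [set v : 'rV[K]_3 | qval Phi v = 0].

Definition conic_point (K : fieldType) (Phi : tqf) (Xi : 'rV[K]_3) : Prop :=
  Xi != 0 /\ conic Phi Xi.

Definition rational_point (R : realType) (Phi : tqf) (Xi : 'rV[R]_3) : Prop :=
  exists2 Q : 'rV[rat]_3, conic_point Phi Q & proj_eq Xi (map_mx ratr Q).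

Definition irrational_point (R : realType) (Phi : tqf) (Xi : 'rV[R]_3) : Prop :=
  conic_point Phi Xi /\ ~ rational_point Phi Xi.

Definition conicZ (Phi : tqf) : set 'rV[int]_3 :=
  [set P : 'rV[int]_3 | \big[gcdn/0%N]_(i < 3) absz (P 0 i) = 1%N /\ qval Phi P = 0].

(* [Sigma] lies on the tangent line at [Xi]: the gradient of Phi at Xi is the
   linear form 2 <Xi, _>. *)
Definition on_tangent (K : fieldType) (Phi : tqf) (Xi Sigma : 'rV[K]_3) : Prop :=
  Sigma != 0 /\ qbil Phi Xi Sigma = 0.

Definition eval_forms (K : fieldType) (a b : nat) (G : 'I_b -> mpoly a rat)
    (x : 'rV[K]_a) : 'rV[K]_b :=
  \row_i mmap (@ratr K) (fun j => x 0 j) (G i).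

(* f, acting on representatives, is a morphism defined over Q between the
   projective varieties with cones X and Y, K being algebraically closed:
   around each point of X it is given by forms of the same degree with rational
   coefficients. A single tuple of forms need not work on all of X. *)
Definition regular_map_over_Q (K : numClosedFieldType) (a b : nat)
    (X : set 'rV[K]_a) (Y : set 'rV[K]_b) (f : 'rV[K]_a -> 'rV[K]_b) : Prop :=
  forall x, X x -> x != 0 ->
    [/\ Y (f x), f x != 0 &
     exists (d : nat) (G : 'I_b -> mpoly a rat),
       [/\ forall i, G i \is ishomog1 d mdeg,
           eval_forms G x != 0 &
           forall y, X y -> y != 0 -> eval_forms G y != 0 ->
             proj_eq (f y) (eval_forms G y)]].

Definition isomorphism_over_Q (K : numClosedFieldType) (a b : nat)
    (X : set 'rV[K]_a) (Y : set 'rV[K]_b) (f : 'rV[K]_a -> 'rV[K]_b) : Prop :=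
  regular_map_over_Q X Y f /\
  exists g : 'rV[K]_b -> 'rV[K]_a,
    [/\ regular_map_over_Q Y X g,
        forall x, X x -> x != 0 -> proj_eq (g (f x)) x &
        forall y, Y y -> y != 0 -> proj_eq (f (g y)) y].

Definition parametrization (R : realType) (Phi : tqf)
    (f : 'rV[R[i]]_3 -> 'rV[R[i]]_2) : Prop :=
  isomorphism_over_Q (conic Phi) [set: 'rV[R[i]]_2] f.

(* f sends [Xi] to the point [xi : 1]. *)
Definition has_coordinate (R : realType) (f : 'rV[R[i]]_3 -> 'rV[R[i]]_2)
    (Xi : 'rV[R]_3) (xi : R) : Prop :=
  proj_eq (f (map_mx (real_complex R) Xi))
          (map_mx (real_complex R) (\row_(j < 2) [:: xi; 1]`_j)).

(* limf_esup, without the topological structure it requires on T. *)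
Definition limsup_along (R : realType) (T : Type) (F : set_system T)
    (f : T -> \bar R) : \bar R :=
  ereal_inf [set ereal_sup [set f x | x in V] | V in F].

(* The trace on conicZ of the neighbourhoods of [Xi] for the quotient topology
   of the real projective plane: [P] is close to [Xi] when some multiple of P
   is close to Xi. *)
Definition conicZ_nbhs (R : realType) (Phi : tqf) (Xi : 'rV[R]_3) :
    set_system 'rV[int]_3 :=
  filter_from (nbhs Xi) (fun V : set 'rV[R]_3 =>
    [set P : 'rV[int]_3 | conicZ Phi P /\
             exists2 c : R, c != 0 & V (c *: map_mx intr P)]).

Definition rat_nbhs (R : realType) (xi : R) : set_system rat :=
  filter_from (nbhs xi) (fun V : set R => [set q : rat | V (ratr q)]).

(* Quotients are taken in \bar R, where x / 0 = +oo for x > 0. *)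
Local Open Scope ereal_scope.

Definition conic_ratio (R : realType) (Phi : tqf) (Sigma : 'rV[R]_3)
    (P : 'rV[int]_3) : \bar R :=
  (Num.sqrt (disc R Phi * `|qval Phi Sigma|)%R)%:E /
  (`|qbil Phi Sigma (map_mx intr P)|%R)%:E.

(* Sigma is any point other than [Xi] of the tangent line at [Xi]. *)
Definition lambda_conic (R : realType) (Phi : tqf) (Xi Sigma : 'rV[R]_3) :
    \bar R :=
  limsup_along (conicZ_nbhs Phi Xi) (conic_ratio Phi Sigma).

(* Sigma is the intersection of the tangent lines at the two points. *)
Definition mu_conic (R : realType) (Phi : tqf) (Sigma : 'rV[R]_3) : \bar R :=
  ereal_sup [set conic_ratio Phi Sigma P | P in conicZ Phi].

Definition lambda_real (R : realType) (xi : R) : \bar R :=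
  limsup_along (rat_nbhs xi) (fun q : rat =>
    1 / ((denq q)%:~R ^+ 2 * `|ratr q - xi|)%R%:E).

Definition lambda_gcd (R : realType) (n : int) (xi : R) : \bar R :=
  limsup_along (rat_nbhs xi) (fun q : rat =>
    (gcdz (denq q) n)%:~R%:E / ((denq q)%:~R ^+ 2 * `|ratr q - xi|)%R%:E).

Definition mu_real (R : realType) (xi xi' : R) : \bar R :=
  ereal_sup [set (`|xi - xi'|%R)%:E /
                 (`|p.1%:~R - p.2%:~R * xi| * `|p.1%:~R - p.2%:~R * xi'|)%R%:E
            | p in [set p : int * int | p != (0, 0)%R]].

Definition mu_gcd (R : realType) (n : int) (xi xi' : R) : \bar R :=
  ereal_sup [set (`|xi - xi'| * (gcdz p.2 n)%:~R)%R%:E /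
                 (`|p.1%:~R - p.2%:~R * xi| * `|p.1%:~R - p.2%:~R * xi'|)%R%:E
            | p in [set p : int * int | p != (0, 0)%R]].

(* For n != 0 the list of divisors is nonempty, so -oo is never the maximum. *)
Definition max_divisors (R : realType) (n : int) (f : R -> \bar R) : \bar R :=
  \big[maxe/-oo]_(d <- divisors `|n|%N) f d%:R%R.

(* Main.v *)
Require Import Defs.
From HB Require Import structures.
From mathcomp Require Import all_boot all_order all_algebra.
From mathcomp Require Import complex.
From mathcomp Require Import -(notations) mpoly.
From mathcomp Require Import all_classical all_reals all_analysis.
From mathcomp Require Import ring lra zify.

Set Implicit Arguments.
Unset Strict Implicit.
Unset Printing Implicit Defensive.

Import Order.TTheory GRing.Theory Num.Theory numFieldNormedType.Exports.

Local Open Scope ring_scope.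

(** Approximation on the conic sees the form only through its primitive
isotropic vectors, so the form may be replaced by its restriction to any
sublattice containing all of them, divided by a common factor of the
values.  This changes the approximation ratio by an explicit constant, and
the point is to reach in this way the form XY - nZ^2, whose primitive
isotropic vectors are known: up to sign they are (n s^2, t^2, s t) / gcd(t, n)
with s, t coprime.

The relation [reduces m M Phi Phi'] records such a replacement: the rows of
the integral matrix M span the sublattice, and restricting Phi to it gives
m |det M| Phi'.  The normalization is chosen so that m is precisely the
factor between the ratios of the two forms; it is a positive integer,
multiplicative under composition ([reduces_trans]), and the discriminants
are related by disc Phi = m^3 |det M| disc Phi' ([reduces_disc]).  When Phi'
is XY - nZ^2, of discriminant n, this reads disc Phi = (m |det M|) (n m^2),
which is the divisibility claimed.

To reach XY - nZ^2, take a basis starting with an isotropic vector and such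
that the form is bXY + cY^2 + eYZ - nZ^2 with b, n > 0 ([adapted]); its
discriminant is b^2 n.  If b = 1, completing X finishes.  Otherwise let p be
a prime dividing b, and consider the form modulo p, which involves only Y
and Z.  When it has no root with Y = 1, all isotropic vectors lie in a proper
sublattice; restricting to it and dividing by p or p^2 lowers the
discriminant.  When it has such a root one may suppose that p divides c,
that is, the root is at Z = 0.  If some prime divides b, c and e, then again
either the form is divisible by that prime or the isotropic vectors lie in a
proper sublattice.  In the
remaining case the root is simple, and taking the isotropic vector
(-c, b, 0) / gcd(b, c) as new base point keeps the discriminant and divides
b by gcd(b, c) > 1.  So b^2 n + b decreases until b = 1
([adapted_reduces], [conic_reduces]).

For XY - nZ^2 everything is explicit.  With coordinate [Z : Y], the real
point of coordinate xi is (n xi^2, 1, xi), and a point Sigma = (x, y, z) of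
the tangent line there satisfies x = 2 n xi z - n xi^2 y.  The ratio at the
point given by s, t is then

  gcd(t, n) 2 |z - xi y| / (|s - t xi| |y (s + t xi) - 2 z t|)

([conic_ratio_std]).  If Sigma also lies on the tangent line at xi', then
2 z = (xi + xi') y and this is the general term of the supremum defining
mu, up to noncoprime pairs, which do not increase the supremum
([mu_conicE]).  If Sigma is arbitrary on one tangent line, the ratio is the
term of the limit superior defining lambda times a factor which tends to 1
as s/t tends to xi ([lambda_conicE]).

Finally, gcd(t, n) trades for the maximum over the divisors d of n: for
fixed s/t, the term of d xi at the fraction d s/t is
gcd(d, t)^2 / d times the term of xi at s/t, and the maximum of
gcd(d, t)^2 / d over d is attained at d = gcd(t, n), with value gcd(t, n)
([lambda_gcd_max], [mu_gcd_max]). *)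

(** * Rows and matrices of size three, values of ternary forms *)

Definition row3 (T : nzRingType) (x y z : T) : 'rV[T]_3 :=
  \row_(j < 3) [:: x; y; z]`_j.

Definition mx3 (T : nzRingType) (r0 r1 r2 : 'rV[T]_3) : 'M[T]_3 :=
  \matrix_(i < 3) nth 0 [:: r0; r1; r2] i.

Lemma row3_eta (T : nzRingType) (v : 'rV[T]_3) : v = row3 (v 0 0) (v 0 1) (v 0 2).
Proof.
apply/rowP => j; rewrite mxE; case: j => [[|[|[|//]]] h] /=;
  by congr (v 0 _); apply: val_inj.
Qed.

Lemma row3_0 (T : nzRingType) (x y z : T) : row3 x y z 0 0 = x.
Proof. by rewrite mxE. Qed.
Lemma row3_1 (T : nzRingType) (x y z : T) : row3 x y z 0 1 = y.
Proof. by rewrite mxE. Qed.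
Lemma row3_2 (T : nzRingType) (x y z : T) : row3 x y z 0 2 = z.
Proof. by rewrite mxE. Qed.

Lemma row3Z (T : nzRingType) (k x y z : T) :
  k *: row3 x y z = row3 (k * x) (k * y) (k * z).
Proof. by rewrite [LHS]row3_eta !mxE. Qed.

Lemma row3D (T : nzRingType) (x y z x' y' z' : T) :
  row3 x y z + row3 x' y' z' = row3 (x + x') (y + y') (z + z').
Proof. by rewrite [LHS]row3_eta !mxE. Qed.

Lemma row3_eq0 (T : nzRingType) (x y z : T) :
  (row3 x y z == 0) = [&& x == 0, y == 0 & z == 0].
Proof.
apply/eqP/and3P => [/rowP h|[/eqP-> /eqP-> /eqP->]].
  by move: (h 0) (h 1) (h 2); rewrite !mxE /= => -> -> ->.
by rewrite [LHS]row3_eta [RHS]row3_eta !mxE.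
Qed.

Lemma map_row3 (T S : nzRingType) (f : {rmorphism T -> S}) (x y z : T) :
  map_mx f (row3 x y z) = row3 (f x) (f y) (f z).
Proof. by rewrite [LHS]row3_eta !mxE. Qed.

Lemma map_mx3 (T S : nzRingType) (f : {rmorphism T -> S}) (r0 r1 r2 : 'rV[T]_3) :
  map_mx f (mx3 r0 r1 r2) = mx3 (map_mx f r0) (map_mx f r1) (map_mx f r2).
Proof.
by apply/matrixP => i j; rewrite !mxE; case: i => [[|[|[|//]]] h]; rewrite /= mxE.
Qed.

Lemma mul_mx3 (T : nzRingType) (x y z : T) (r0 r1 r2 : 'rV[T]_3) :
  row3 x y z *m mx3 r0 r1 r2 = x *: r0 + y *: r1 + z *: r2.
Proof.
by apply/rowP => j; rewrite !mxE !big_ord_recl big_ord0 !mxE /= addr0 !addrA.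
Qed.

Lemma det_mx3 (T : comNzRingType) (a b c d e f g h i : T) :
  \det (mx3 (row3 a b c) (row3 d e f) (row3 g h i)) =
  a * (e * i - f * h) - b * (d * i - f * g) + c * (d * h - e * g).
Proof.
rewrite (expand_det_row _ 0) !big_ord_recl big_ord0 /cofactor.
rewrite !(expand_det_row _ ord0) !big_ord_recl !big_ord0 /cofactor !det_mx11.
by rewrite !mxE /= ?mxE /= /bump /=; ring.
Qed.

Lemma qval_row3 (K : comNzRingType) (Phi : tqf) (x y z : K) :
  qval Phi (row3 x y z) =
  (cA Phi)%:~R * x ^+ 2 + (cB Phi)%:~R * x * y + (cC Phi)%:~R * y ^+ 2 +
  (cD Phi)%:~R * x * z + (cE Phi)%:~R * y * z + (cF Phi)%:~R * z ^+ 2.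
Proof. by rewrite /qval row3_0 row3_1 row3_2. Qed.

Lemma qvalZ (K : comNzRingType) (Phi : tqf) (k : K) (v : 'rV[K]_3) :
  qval Phi (k *: v) = k ^+ 2 * qval Phi v.
Proof. by rewrite /qval !mxE; ring. Qed.

Lemma qval_intr (K : comNzRingType) (Phi : tqf) (v : 'rV[int]_3) :
  qval Phi (map_mx intr v) = (qval Phi v)%:~R :> K.
Proof. by rewrite /qval !mxE !intz !(rmorphD, rmorphM, rmorphXn). Qed.

(** * Contents of integer rows *)

Lemma primitive_row3 (x y z : int) :
  \big[gcdn/0%N]_(i < 3) absz (row3 x y z 0 i) = gcdn `|x| (gcdn `|y| `|z|).
Proof. by rewrite !big_ord_recl big_ord0 !mxE /= gcdn0. Qed.

Lemma conicZ_row3 (Phi : tqf) (x y z : int) :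
  conicZ Phi (row3 x y z) <->
  gcdn `|x| (gcdn `|y| `|z|) = 1%N /\ qval Phi (row3 x y z) = 0.
Proof. by rewrite /conicZ /= primitive_row3. Qed.

Lemma content_dvd (v : 'rV[int]_3) (i : 'I_3) :
  ((\big[gcdn/0]_(j < 3) absz (v ord0 j)) %| `|v ord0 i|)%N.
Proof. by rewrite (bigD1 i) //= dvdn_gcdl. Qed.

Lemma dvd_content (d : nat) (v : 'rV[int]_3) :
  (forall i : 'I_3, (d %| `|v ord0 i|)%N) ->
  (d %| \big[gcdn/0]_(j < 3) absz (v ord0 j))%N.
Proof.
move=> h; elim/big_ind: _ => [|x y hx hy|i _]; [exact: dvdn0| |exact: h].
by rewrite dvdn_gcd hx.
Qed.

Lemma contentZ (k : int) (v : 'rV[int]_3) :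
  \big[gcdn/0]_(i < 3) absz ((k *: v) ord0 i) =
  (`|k| * \big[gcdn/0]_(i < 3) absz (v ord0 i))%N.
Proof.
by rewrite [v]row3_eta row3Z !primitive_row3 !abszM !muln_gcdr.
Qed.

Lemma primitive_part (Q : 'rV[int]_3) : Q != 0 ->
  exists (g : int) (w : 'rV[int]_3), [/\ 0 < g,
    \big[gcdn/0]_(j < 3) absz (w ord0 j) = 1%N & Q = g *: w].
Proof.
move=> nQ; set g := \big[gcdn/0]_(j < 3) absz (Q ord0 j).
have gd i : (g %| `|Q ord0 i|)%N by exact: content_dvd.
have g0 : (0 < g)%N.
  rewrite lt0n; apply: contra nQ => /eqP g0; apply/eqP/rowP => i.
  by move: (gd i); rewrite g0 dvd0n absz_eq0 mxE => /eqP.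
pose w : 'rV[int]_3 := \row_i (Q ord0 i %/ g)%Z.
have QE : Q = g%:Z *: w.
  by apply/rowP => i; rewrite !mxE mulrC divzK // dvdzE gd.
exists g, w; split=> //.
have := contentZ g%:Z w; rewrite -QE -/g => gE.
by apply/eqP; rewrite -(eqn_pmul2l g0) muln1 eq_sym; apply/eqP.
Qed.

Lemma scale_row_inj (p : nat) (k : int) : k != 0 ->
  injective ( *:%R k : 'rV[int]_p -> 'rV[int]_p).
Proof.
move=> k0 u v /rowP uv; apply/rowP => j.
by apply: (mulfI k0); have := uv j; rewrite !mxE.
Qed.

(** * Restricting a form to a sublattice that contains its isotropic vectors *)

(** The rows of M span the sublattice. The identity is asked over every
commutative ring at once because the same M serves over the integers, the
rationals, the reals and the complex numbers. The scaling factor is split as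
m |det M| so that m is the factor between the approximation ratios of Phi
and Phi'. *)
Definition reduces (m : int) (M : 'M[int]_3) (Phi Phi' : tqf) : Prop :=
  [/\ 0 < m, \det M != 0,
      forall (K : comNzRingType) (v : 'rV[K]_3),
        qval Phi (v *m map_mx intr M) = (m * `|\det M|)%:~R * qval Phi' v &
      forall P, conicZ Phi P -> exists v, P = v *m M].

Lemma map_intr_mx (p q : nat) (A : 'M[int]_(p, q)) : map_mx intr A = A.
Proof. by apply/matrixP => i j; rewrite mxE intz. Qed.

(** The coordinates of a primitive vector with respect to the rows of M have no
common factor either, since such a factor would divide the vector. *)
Lemma reduces_pull m M Phi Phi' P : reduces m M Phi Phi' -> conicZ Phi P ->
  exists2 v, conicZ Phi' v & P = v *m M.
Proof.
case=> m0 d0 hq hP cP; have [v ev] := hP _ cP; exists v => //.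
case: cP => pP qP; split.
  suff : (\big[gcdn/0]_(i < 3) absz (v ord0 i) %|
           \big[gcdn/0]_(i < 3) absz (P ord0 i))%N by rewrite pP dvdn1 => /eqP.
  apply: dvd_content => i; rewrite ev mxE.
  suff : (Posz (\big[gcdn/0%N]_(i < 3) absz (v ord0 i)) %| \sum_j v ord0 j * M j i)%Z by [].
  by apply: rpred_sum => j _; apply: dvdz_mulr; exact: content_dvd.
have := hq int v; rewrite map_intr_mx -ev qP => /esym/eqP.
by rewrite mulf_eq0 intz mulf_eq0 gt_eqF //= normr_eq0 (negPf d0) => /eqP.
Qed.

Lemma reduces_trans m1 M1 m2 M2 Phi1 Phi2 Phi3 :
  reduces m1 M1 Phi1 Phi2 -> reduces m2 M2 Phi2 Phi3 ->
  reduces (m1 * m2) (M2 *m M1) Phi1 Phi3.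
Proof.
move=> r1 r2; have [m10 d1 q1 _] := r1; have [m20 d2 q2 _] := r2; split.
- exact: mulr_gt0.
- by rewrite det_mulmx mulf_neq0.
- move=> K v; rewrite map_mxM mulmxA q1 q2 det_mulmx normrM mulrA.
  by rewrite -intrM; congr (_%:~R * _); ring.
- move=> P cP; have [v cv ->] := reduces_pull r1 cP.
  by have [w _ ->] := reduces_pull r2 cv; exists w; rewrite mulmxA.
Qed.

Lemma unimodular_row (M : 'M[int]_3) (P : 'rV[int]_3) :
  M \in unitmx -> exists v, P = v *m M.
Proof. by move=> uM; exists (P *m invmx M); rewrite mulmxKV. Qed.

(** The containment is automatic here: the rows of a unimodular M span the whole
lattice. *)
Lemma reduces_unimodular (M : 'M[int]_3) (Phi Phi' : tqf) :
  `|\det M| = 1 ->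
  (forall (K : comNzRingType) (v : 'rV[K]_3),
     qval Phi (v *m map_mx intr M) = qval Phi' v) ->
  reduces 1 M Phi Phi'.
Proof.
move=> d1 hq; split=> //; first by rewrite -normr_eq0 d1.
  by move=> K v; rewrite hq d1 mulr1 mul1r.
move=> P _; apply: unimodular_row; rewrite unitmxE.
by apply/unitrPr; exists (\det M); rewrite -expr2 -[_ ^+ 2]real_normK ?num_real // d1.
Qed.

(** * Forms adapted to an isotropic vector *)

(** The shape of a form in a basis starting with an isotropic vector whose
tangent line is Y = 0. The sign of n makes the discriminant b^2 n; in
particular adapted 1 0 0 n is XY - nZ^2. *)
Definition adapted (b c e n : int) : tqf := Tqf 0 b c 0 e (- n).

Lemma qval_adapted (K : comNzRingType) (b c e n : int) (x y z : K) :
  qval (adapted b c e n) (row3 x y z) =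
  y * (b%:~R * x + c%:~R * y + e%:~R * z) - n%:~R * z ^+ 2.
Proof. by rewrite qval_row3 /= rmorphN /=; ring. Qed.

Lemma reduces_shift (b c e n s : int) :
  reduces 1 (mx3 (row3 1 0 0) (row3 0 1 s) (row3 0 0 1))
    (adapted b c e n) (adapted b (c + e * s - n * s ^+ 2) (e - 2 * n * s) n).
Proof.
apply: reduces_unimodular => [|K v].
  by rewrite det_mx3 !(mulr0, mul0r, subr0, mulr1, addr0) normr1.
rewrite [v]row3_eta map_mx3 !map_row3 /= mul_mx3 !row3Z !row3D !qval_adapted.
by ring.
Qed.

Lemma reduces_drop (c e n : int) :
  reduces 1 (mx3 (row3 1 0 0) (row3 (- c) 1 0) (row3 (- e) 0 1))
    (adapted 1 c e n) (adapted 1 0 0 n).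
Proof.
apply: reduces_unimodular => [|K v].
  by rewrite det_mx3 !(mulr0, mul0r, subr0, mulr1, addr0) normr1.
rewrite [v]row3_eta map_mx3 !map_row3 /= mul_mx3 !row3Z !row3D !qval_adapted.
by ring.
Qed.

(** All sublattices used in the descent have this shape: p divides Y and q
divides Z on isotropic vectors. The four equations say that the restricted
form is divisible by k p q. Taking p = q = 1 covers plain division of the
form by k. *)
Lemma reduces_diag (p q k : int) (b c e n b' c' e' n' : int) :
  0 < p -> 0 < q -> 0 < k ->
  b * p = k * p * q * b' -> c * p ^+ 2 = k * p * q * c' ->
  e * p * q = k * p * q * e' -> n * q ^+ 2 = k * p * q * n' ->
  (forall x y z, conicZ (adapted b c e n) (row3 x y z) -> (p %| y)%Z && (q %| z)%Z) ->
  reduces k (mx3 (row3 1 0 0) (row3 0 p 0) (row3 0 0 q))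
    (adapted b c e n) (adapted b' c' e' n').
Proof.
move=> p0 q0 k0 hb hc he hn hP.
have dE : \det (mx3 (row3 1 0 0) (row3 0 p 0) (row3 0 0 q)) = p * q.
  by rewrite det_mx3; ring.
split=> //; first by rewrite dE mulf_neq0 // gt_eqF.
  move=> K v; rewrite dE normrM !gtr0_norm //.
  rewrite [v]row3_eta map_mx3 !map_row3 /= mul_mx3 !row3Z !row3D !qval_adapted.
  move/(congr1 (intr : int -> K)): hb; move/(congr1 (intr : int -> K)): hc.
  move/(congr1 (intr : int -> K)): he; move/(congr1 (intr : int -> K)): hn.
  rewrite !(rmorphM, rmorphXn) /= => hn he hc hb.
  set x := v 0 0; set y := v 0 1; set z := v 0 2.
  transitivity ((b%:~R * p%:~R) * x * y + (c%:~R * p%:~R ^+ 2) * y ^+ 2 +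
    (e%:~R * p%:~R * q%:~R) * y * z - (n%:~R * q%:~R ^+ 2) * z ^+ 2 : K).
    by ring.
  by rewrite hb hc he hn; ring.
move=> P; rewrite [P]row3_eta => /hP/andP[/dvdzP[y ->] /dvdzP[z ->]].
exists (row3 (P 0 0) y z); rewrite mul_mx3 !row3Z !row3D.
by congr row3; ring.
Qed.

Lemma conicZ_adapted b c e n x y z : conicZ (adapted b c e n) (row3 x y z) ->
  y * (b * x + c * y + e * z) = n * z ^+ 2.
Proof.
by case/conicZ_row3 => _; rewrite qval_adapted !intz => /eqP; rewrite subr_eq0 => /eqP.
Qed.

(** * Bilinear forms, discriminants and changes of basis *)

(** The matrix defining the discriminant represents the polar form, so that
discriminants can be compared through Gram matrices. *)
Lemma qbilE (K : numFieldType) (Phi : tqf) (P Q : 'rV[K]_3) :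
  qbil Phi P Q = (P *m qmatrix K Phi *m Q^T) 0 0.
Proof.
rewrite [P]row3_eta [Q]row3_eta /qbil row3D !qval_row3.
rewrite !mxE !big_ord_recl big_ord0 !mxE /= !big_ord_recl !big_ord0 !mxE /=.
by field.
Qed.

Lemma reduces_qbil (K : numFieldType) m M Phi Phi' (P Q : 'rV[K]_3) :
  reduces m M Phi Phi' ->
  qbil Phi (P *m map_mx intr M) (Q *m map_mx intr M) =
  (m * `|\det M|)%:~R * qbil Phi' P Q.
Proof. by case=> _ _ hq _; rewrite /qbil -mulmxDl !hq; ring. Qed.

(** The Gram matrix of the rows of M for Phi is m |det M| times the matrix of
Phi'; compare determinants. *)
Lemma reduces_disc (K : numFieldType) m M Phi Phi' : reduces m M Phi Phi' ->
  disc K Phi = (m ^+ 3 * `|\det M|)%:~R * disc K Phi'.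
Proof.
move=> r; have [m0 d0 _ _] := r.
set D : 'M[K]_3 := map_mx intr M.
have DE : D *m qmatrix K Phi *m D^T = (m * `|\det M|)%:~R *: qmatrix K Phi'.
  apply/matrixP => i j.
  have := reduces_qbil (delta_mx 0 i : 'rV[K]_3) (delta_mx 0 j) r.
  rewrite !qbilE trmx_mul !mulmxA trmx_delta -mulmxA -!rowE.
  rewrite mulmxA -/D => h.
  have colj k (A : 'M[K]_3) : (row k A *m delta_mx j 0 : 'cV_1) 0 0 = A k j.
    by rewrite -colE !mxE.
  by rewrite [RHS]mxE -(colj _ (qmatrix K Phi')) -h -colj !row_mul.
move/(congr1 determinant): DE; rewrite !det_mulmx det_tr detZ det_map_mx.
set d := \det M in d0 *; rewrite /disc => h.
have d2 : (d%:~R : K) ^+ 2 = (`|d|%:~R) ^+ 2 by case: (ger0P d) => _; rewrite ?rmorphN ?sqrrN.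
have d0' : (`|d|%:~R : K) != 0 by rewrite intr_eq0 normr_eq0.
apply: (mulfI (expf_neq0 2 d0')); rewrite -[in LHS]d2.
transitivity (4 * (d%:~R * \det (qmatrix K Phi) * d%:~R)); first by ring.
by rewrite h; ring.
Qed.

Lemma disc_adapted (K : numFieldType) (b c e n : int) :
  disc K (adapted b c e n) = (b ^+ 2 * n)%:~R.
Proof.
rewrite /disc.
have -> : qmatrix K (adapted b c e n) = mx3 (row3 0 (b%:~R / 2) 0)
  (row3 (b%:~R / 2) c%:~R (e%:~R / 2)) (row3 0 (e%:~R / 2) (- n%:~R)).
  apply/matrixP=> i j; rewrite !mxE.
  by case: i => [[|[|[|//]]] hi]; case: j => [[|[|[|//]]] hj];
    rewrite /= ?mxE /= ?mul0r ?rmorphN.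
by rewrite det_mx3; field.
Qed.

(** The linear form BY + DZ is gcd(B, D) times a primitive one, which a
unimodular change of Y and Z given by the Bezout relation makes equal to the
coordinate Y. The value of n is recorded through the invariance of the
discriminant. *)
Lemma reduces_isotropic_row (B C D E F : int) : gcdz B D != 0 ->
  exists M c e n, reduces 1 M (Tqf 0 B C D E F) (adapted (gcdz B D) c e n) /\
    n * gcdz B D ^+ 2 = E * D * B - C * D ^+ 2 - F * B ^+ 2.
Proof.
have [u [w]] := Bezoutz B D.
have := dvdz_gcdr B D; have := dvdz_gcdl B D.
move: (gcdz B D) => g /dvdzP[B' ->] /dvdzP[D' ->] hg g0.
(* Divide the Bezout relation by the gcd: the new basis is unimodular. *)
have h1 : u * B' + w * D' = 1.
  by apply: (mulIf g0); rewrite mul1r -[RHS]hg; ring.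
exists (mx3 (row3 1 0 0) (row3 0 u w) (row3 0 (- D') B')).
exists (C * u ^+ 2 + E * u * w + F * w ^+ 2).
exists (2 * F * w * B' - 2 * C * u * D' + E * (u * B' - w * D')).
exists (E * D' * B' - C * D' ^+ 2 - F * B' ^+ 2); split; last by ring.
apply: reduces_unimodular => [|K v].
  rewrite det_mx3 (_ : _ + _ = u * B' + w * D'); last by ring.
  by rewrite h1 normr1.
rewrite [v]row3_eta map_mx3 !map_row3 /= mul_mx3 !row3Z !row3D qval_adapted qval_row3 /=.
have gE : g%:~R = g%:~R * (u%:~R * B'%:~R + w%:~R * D'%:~R) :> K.
  by rewrite -!intrM -intrD h1 mulr1.
by rewrite [in RHS]gE; ring.
Qed.

(** The coefficients of the form in the new basis are the values and the polar
values of the basis vectors, and the first value vanishes. *)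
Lemma reduces_basechange (Phi : tqf) (M : 'M[int]_3) : `|\det M| = 1 ->
  qval Phi (row 0 M) = 0 ->
  exists B C D E F, reduces 1 M Phi (Tqf 0 B C D E F).
Proof.
move=> d1 q0.
pose pol (i j : 'I_3) : int :=
  qval Phi (row i M + row j M) - qval Phi (row i M) - qval Phi (row j M).
exists (pol 0 1), (qval Phi (row 1 M)), (pol 0 2), (pol 1 2), (qval Phi (row 2 M)).
apply: reduces_unimodular => // K v; rewrite -[0]q0 {q0 d1} /pol.
have -> : map_mx intr M = mx3 (map_mx intr (row 0 M)) (map_mx intr (row 1 M))
    (map_mx intr (row 2 M)) :> 'M[K]_3.
  apply/matrixP => i j; rewrite !mxE; case: i => [[|[|[|//]]] hi];
    by rewrite /= !mxE; congr (_%:~R); congr (M _ j); apply: val_inj.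
rewrite [v]row3_eta [row 0 M]row3_eta [row 1 M]row3_eta [row 2 M]row3_eta.
rewrite !map_row3 /= mul_mx3 !row3Z !row3D !qval_row3 /= !intz.
by ring.
Qed.

(** * Descent to the form XY - nZ^2 *)

(** The vector (- c, b, 0) / gcd(b, c) is isotropic; a Bezout relation for b and
c completes it to a basis. In that basis the linear form pairing with it has
coefficients b and b e / gcd(b, c), whose gcd is b / gcd(b, c) because
gcd(b, c) and e are coprime. *)
Lemma adapted_move (b c e n : int) : 0 < b -> gcdz (gcdz b c) e = 1 ->
  exists M b' c' e' n', [/\ reduces 1 M (adapted b c e n) (adapted b' c' e' n'),
    b = b' * gcdz b c, 0 < b' & b' ^+ 2 * n' = b ^+ 2 * n].
Proof.
move=> b0; set g := gcdz b c => ge1.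
have g0 : 0 < g.
  by rewrite lt_def gcdz_eq0 negb_and gt_eqF.
have [u [w]] := Bezoutz b c; rewrite -/g => hg.
have /dvdzP[b1 hb] : (g %| b)%Z by exact: dvdz_gcdl.
have /dvdzP[c1 hc] : (g %| c)%Z by exact: dvdz_gcdr.
clearbody g.
have h1 : u * b1 + w * c1 = 1.
  by apply: (mulIf (lt0r_neq0 g0)); rewrite mul1r -[RHS]hg hb hc; ring.
have b10 : 0 < b1 by rewrite -(pmulr_lgt0 _ g0) -hb.
(* This gcd is the new b. *)
have gcdE : gcdz b (b1 * e) = b1.
  by rewrite hb -mulz_gcdr ge1 mulr1 gez0_abs // ltW.
pose M1 := mx3 (row3 (- c1) b1 0) (row3 u w 0) (row3 0 0 1).
have r1 : reduces 1 M1 (adapted b c e n) (Tqf 0 b (w * g) (b1 * e) (w * e) (- n)).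
  apply: reduces_unimodular => [|K v].
    rewrite det_mx3 (_ : _ + _ = - (u * b1 + w * c1)); last by ring.
    by rewrite h1 normrN1.
  rewrite [v]row3_eta map_mx3 !map_row3 /= mul_mx3 !row3Z !row3D qval_adapted qval_row3 /=.
  have gE : g%:~R * 1 = g%:~R * (u%:~R * b1%:~R + w%:~R * c1%:~R) :> K.
    by rewrite -!intrM -intrD h1.
  rewrite mulr1 in gE.
  rewrite hb hc; set X := v 0 0; set Y := v 0 1; set Z := v 0 2.
  transitivity ((b1%:~R * X + w%:~R * Y) *
    ((g%:~R * (u%:~R * b1%:~R + w%:~R * c1%:~R)) * Y + e%:~R * Z) -
    n%:~R * Z ^+ 2 : K); first by ring.
  by rewrite -gE; ring.
have b1n0 := lt0r_neq0 b10.
have [|M [c' [e' [n' [r2 hn]]]]] :=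
  @reduces_isotropic_row b (w * g) (b1 * e) (w * e) (- n); first by rewrite gcdE.
rewrite gcdE in r2 hn; exists (M *m M1), b1, c', e', n'; split => //.
  by rewrite -[1]mul1r; exact: reduces_trans r1 r2.
by rewrite mulrC hn hb; ring.
Qed.

Lemma prime_dvdz_mul (p : nat) (x y : int) : prime p ->
  (p %| x * y)%Z = (p %| x)%Z || (p %| y)%Z.
Proof. by move=> pp; rewrite !dvdzE abszM Euclid_dvdM. Qed.

Lemma prime_dvdz_sqr (p : nat) (x : int) : prime p -> (p %| x ^+ 2)%Z -> (p %| x)%Z.
Proof. by move=> pp; rewrite expr2 prime_dvdz_mul // orbb. Qed.

Lemma prime_inv_mod (p : nat) (y : int) : prime p -> ~~ (p %| y)%Z ->
  exists y', (p %| y * y' - 1)%Z.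
Proof.
move=> pp npy; have [u [w h]] := Bezoutz y p.
exists u; have g1 : gcdz y p = 1.
  rewrite /gcdz; congr Posz; apply/eqP; rewrite -/(coprime _ _) coprime_sym.
  by rewrite prime_coprime.
by rewrite -g1 -h mulrC (_ : _ - _ = - w * p) ?dvdz_mull //; ring.
Qed.

(** Descent on b^2 n + b: moving the base point preserves b^2 n and lowers b,
while restricting to a sublattice or dividing the form lowers b^2 n without
raising b. *)
Lemma adapted_reduces (b c e n : int) : 0 < b -> 0 < n ->
  exists m M (n' : int), 0 < n' /\ reduces m M (adapted b c e n) (adapted 1 0 0 n').
Proof.
have [k] := ubnP `|(b ^+ 2 * n + b)%R|%N; elim: k => // k IH in b c e n *.
move=> hk b0 n0.
have step m1 M1 b' c' e' n' : reduces m1 M1 (adapted b c e n) (adapted b' c' e' n') ->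
    0 < b' -> 0 < n' -> b' ^+ 2 * n' + b' < b ^+ 2 * n + b ->
    exists m M n', 0 < n' /\ reduces m M (adapted b c e n) (adapted 1 0 0 n').
  move=> r b'0 n'0 lt; have [|m [M [n1 [n10 r']]]] := IH b' c' e' n' _ b'0 n'0.
    have := addr_ge0 (mulr_ge0 (sqr_ge0 b') (ltW n'0)) (ltW b'0).
    by move: lt hk; move: (_ + _) (_ + _) => A B; lia.
  by exists (m1 * m), (M *m M1), n1; split=> //; exact: reduces_trans r r'.
have smaller (r b' n' : int) (j : nat) : 1 < r -> 0 < b' -> 0 < n' -> b' <= b ->
    b ^+ 2 * n = b' ^+ 2 * n' * r ^+ j.+1 -> b' ^+ 2 * n' + b' < b ^+ 2 * n + b.
  move=> r1 b'0 n'0 le ->; apply: ltr_leD => //.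
  by rewrite ltr_pMr ?exprn_egt1 // mulr_gt0 // exprn_gt0.
have dvd_le (r b' : int) : 1 < r -> 0 < b' -> b = b' * r -> b' <= b.
  by move=> r1 b'0 ->; rewrite ler_peMr // ltW.
have [b1|nb1] := eqVneq b 1.
  by exists 1, (mx3 (row3 1 0 0) (row3 (- c) 1 0) (row3 (- e) 0 1)), n; split=> //;
    rewrite b1; exact: reduces_drop.
have [p pp pb] : exists2 p : nat, prime p & (p %| b)%Z.
  have b1 : (1 < `|b|)%N by lia.
  by exists (pdiv `|b|); [exact: pdiv_prime | rewrite dvdzE pdiv_dvd].
have p0 : 0 < p%:Z by rewrite ltz_nat prime_gt0.
have p1 : 1 < p%:Z by rewrite ltz_nat prime_gt1.
(* A root s of the form modulo p with Y = 1; shifting Z by s Y moves it to Z = 0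
   and makes p divide the coefficient of Y^2. *)
have [[s hs]|nos] := pselect (exists s, (p %| c + e * s - n * s ^+ 2)%Z).
  set c0 := c + e * s - n * s ^+ 2 in hs; pose e0 := e - 2 * n * s.
  have r0 := reduces_shift b c e n s; rewrite -/c0 -/e0 in r0.
  have [g1|gn1] := eqVneq (gcdz (gcdz b c0) e0) 1.
    have [M [b' [c' [e' [n' [r1 hb b'0 hd]]]]]] := adapted_move n b0 g1.
    have n'0 : 0 < n' by rewrite -(pmulr_rgt0 _ (exprn_gt0 2 b'0)) hd mulr_gt0 ?exprn_gt0.
    apply: (step _ _ _ _ _ _ (reduces_trans r0 r1) b'0 n'0); rewrite hd ltrD2l hb.
    have pg : (p %| gcdz b c0)%Z by rewrite dvdz_gcd pb.
    have g0 : 0 < gcdz b c0 by rewrite lt_def gcdz_eq0 negb_and gt_eqF.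
    rewrite ltr_pMr //; apply: lt_le_trans p1 _.
    by move: pg g0; rewrite /gcdz dvdzE ltz_nat lez_nat => pg g0; exact: dvdn_leq.
  (* A prime r dividing b, c0 and e0: modulo r the form is - n Z^2, so either r
     divides the form or r divides Z on isotropic vectors. *)
  have [r pr rg] : exists2 r : nat, prime r & (r %| gcdz (gcdz b c0) e0)%Z.
    exists (pdiv `|gcdz (gcdz b c0) e0|); last by rewrite dvdzE pdiv_dvd.
    apply: pdiv_prime; have : gcdz (gcdz b c0) e0 != 0.
      by rewrite gcdz_eq0 gcdz_eq0 gt_eqF.
    by move: gn1; move: (gcdz _ _) (@isT : 0 <= gcdz (gcdz b c0) e0) => g; lia.
  have r1 : 1 < r%:Z by rewrite ltz_nat prime_gt1.
  have rp0 : 0 < r%:Z by rewrite ltz_nat prime_gt0.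
  move: rg; rewrite !dvdz_gcd => /andP[/andP[/dvdzP[b' hb] /dvdzP[c' hc]] /dvdzP[e' he]].
  have b'0 : 0 < b' by rewrite -(pmulr_lgt0 _ rp0) -hb.
  have [/dvdzP[n' hn]|nrn] := boolP (r %| n)%Z.
    have n'0 : 0 < n' by rewrite -(pmulr_lgt0 _ rp0) -hn.
    have r2 : reduces r (mx3 (row3 1 0 0) (row3 0 1 0) (row3 0 0 1))
        (adapted b c0 e0 n) (adapted b' c' e' n').
      apply: reduces_diag => //; rewrite ?hb ?hc ?he ?hn; try ring.
      by move=> x y z _; rewrite !dvd1z.
    by apply: (step _ _ _ _ _ _ (reduces_trans r0 r2) b'0 n'0);
      apply: (smaller r _ _ 2) (dvd_le _ _ r1 b'0 hb) _ => //; rewrite hb hn; ring.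
  have r2 : reduces 1 (mx3 (row3 1 0 0) (row3 0 1 0) (row3 0 0 r%:Z))
      (adapted b c0 e0 n) (adapted b' c' e0 (r%:Z * n)).
    apply: reduces_diag => //; rewrite ?hb ?hc; try ring.
    move=> x y z cz; rewrite dvd1z /=.
    have : (r %| n * z ^+ 2)%Z.
      rewrite -(conicZ_adapted cz) he dvdz_mull //.
      by rewrite (_ : _ + _ = (b' * x + c' * y + e' * z) * r%:Z) ?dvdz_mull //; ring.
    by rewrite prime_dvdz_mul // (negPf nrn) => /prime_dvdz_sqr ->.
  by apply: (step _ _ _ _ _ _ (reduces_trans r0 r2) b'0); rewrite ?mulr_gt0 //;
    apply: (smaller r _ _ 0) (dvd_le _ _ r1 b'0 hb) _; rewrite ?mulr_gt0 // hb; ring.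
(* If Y were invertible modulo p, then Z / Y would be a root. *)
have py x y z : conicZ (adapted b c e n) (row3 x y z) -> (p %| y)%Z.
  move=> /conicZ_adapted h; apply: contraT => npy; case: nos.
  have [y' hy'] := prime_inv_mod pp npy.
  exists (z * y').
  (* Modulo p, the left side is y'^2 times the value of the form at (x, y, z). *)
  have -> : c + e * (z * y') - n * (z * y') ^+ 2 =
     (1 - y * y') * (c * (1 + y * y') + e * z * y') - b * x * y * y' ^+ 2.
    have -> : n * (z * y') ^+ 2 = y' ^+ 2 * (n * z ^+ 2) by ring.
    by rewrite -h; ring.
  rewrite rpredB //; last by rewrite -!mulrA dvdz_mulr.
  by rewrite -opprB mulNr rpredN dvdz_mulr.
have [b' hb] := dvdzP pb.
have b'0 : 0 < b' by rewrite -(pmulr_lgt0 _ p0) -hb.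
(* If p divides n, replacing Y by p Y already makes the form divisible by p. *)
have [/dvdzP[n' hn]|npn] := boolP (p %| n)%Z.
  have n'0 : 0 < n' by rewrite -(pmulr_lgt0 _ p0) -hn.
  have r2 : reduces 1 (mx3 (row3 1 0 0) (row3 0 p%:Z 0) (row3 0 0 1))
      (adapted b c e n) (adapted b (p%:Z * c) e n').
    apply: reduces_diag => //; rewrite ?hn; try ring.
    by rewrite -hn => x y z /py ->; rewrite dvd1z.
  apply: (step _ _ _ _ _ _ r2) => //.
  by apply: (smaller p _ _ 0) => //; rewrite hn; ring.
(* Here n is prime to p, so p divides Z together with Y and the form becomes
   divisible by p^2. *)
have r2 : reduces 1 (mx3 (row3 1 0 0) (row3 0 p%:Z 0) (row3 0 0 p%:Z))
    (adapted b c e n) (adapted b' c e n).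
  apply: reduces_diag => //; rewrite ?hb; try ring.
  rewrite -hb => x y z cz; rewrite (py _ _ _ cz) /=.
  have : (p %| n * z ^+ 2)%Z.
    by rewrite -(conicZ_adapted cz) dvdz_mulr // (py _ _ _ cz).
  by rewrite prime_dvdz_mul // (negPf npn) => /prime_dvdz_sqr ->.
apply: (step _ _ _ _ _ _ r2) => //.
by apply: (smaller p _ _ 1) (dvd_le _ _ p1 b'0 hb) _ => //; rewrite hb; ring.
Qed.

(** * Every isotropic form of positive discriminant reduces to XY - nZ^2 *)

Lemma isotropic_conicZ (Phi : tqf) : isotropic Phi -> exists P, conicZ Phi P.
Proof.
case=> P nP qP.
(* Clear denominators. *)
have [k k0 [Q PE]] : exists2 k : int, k != 0 & exists Q : 'rV[int]_3, k%:~R *: P = map_mx intr Q.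
  exists (denq (P 0 0) * denq (P 0 1) * denq (P 0 2)); first by rewrite !mulf_neq0 ?denq_neq0.
  exists (row3 (numq (P 0 0) * denq (P 0 1) * denq (P 0 2))
    (denq (P 0 0) * numq (P 0 1) * denq (P 0 2))
    (denq (P 0 0) * denq (P 0 1) * numq (P 0 2))).
  rewrite map_row3 {4}[P]row3_eta row3Z !intrM.
  have dq (q : rat) : (denq q)%:~R * q = (numq q)%:~R by rewrite mulrC numqE.
  by congr row3; rewrite !rmorphM /= -dq; ring.
have nQ : Q != 0.
  apply: contra nP => /eqP Q0; move: PE; rewrite Q0 map_mx0 => /eqP.
  by rewrite scaler_eq0 intr_eq0 (negPf k0).
have qQ : qval Phi Q = 0.
  by apply/eqP; rewrite -(intr_eq0 rat) -qval_intr -PE qvalZ qP mulr0.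
have [g [w [g0 pw QE]]] := primitive_part nQ.
exists w; split=> //; apply/eqP; move/eqP: qQ.
by rewrite QE qvalZ mulf_eq0 expf_eq0 /= gt_eqF.
Qed.

(** The Smith normal form of a single row is a multiple of the first row of a
unimodular matrix, and the multiple is a unit when the row is primitive. *)
Lemma unimodular_completion (P : 'rV[int]_3) :
  \big[gcdn/0]_(j < 3) absz (P ord0 j) = 1%N ->
  exists2 M : 'M[int]_3, `|\det M| = 1 & row 0 M = P \/ row 0 M = - P.
Proof.
move=> pP; have [L uL [M uM [d _ PE]]] := int_Smith_normal_form P.
have unit_abs (x : int) : x \is a GRing.unit -> `|x| = 1.
  by case/unitrP => y [/(congr1 absz)/eqP + _]; rewrite abszM muln_eq1 => /andP[_ /eqP]; lia.
exists M; first by apply: unit_abs; rewrite -unitmxE.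
set k := L 0 0 * d`_0.
have PkM : P = k *: row 0 M.
  apply/rowP => j; rewrite PE !mxE big_ord_recl big1 ?addr0.
    by rewrite !mxE big_ord1 !mxE /= mulr1n; congr (_ * M _ j); apply: val_inj.
  by move=> i _; rewrite !mxE big_ord1 !mxE /= mulr0 mul0r.
have : (`|k| %| 1)%N.
  rewrite -pP; apply: dvd_content => i; rewrite PkM mxE abszM; exact: dvdn_mulr.
rewrite dvdn1 => /eqP k1; have /orP[/eqP kE|/eqP kE] : (k == 1) || (k == -1) by lia.
  by left; rewrite PkM kE scale1r.
by right; rewrite PkM kE scaleN1r opprK.
Qed.

Theorem conic_reduces (Phi : tqf) : isotropic Phi -> 0 < disc rat Phi ->
  exists m M (n : int), 0 < n /\ reduces m M Phi (adapted 1 0 0 n).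
Proof.
move=> /isotropic_conicZ[P [pP qP]] d0.
have [M d1 rM] := unimodular_completion pP.
have q0 : qval Phi (row 0 M) = 0.
  by case: rM => -> //; rewrite -scaleN1r qvalZ qP mulr0.
have [B [C [D [E [F r1]]]]] := reduces_basechange d1 q0.
(* The discriminant being nonzero, the polar form does not vanish identically
   on the isotropic vector. *)
have dE := reduces_disc rat r1; rewrite d1 expr1n mulr1 mul1r in dE.
have g0 : gcdz B D != 0.
  apply: contraTneq d0 => /eqP; rewrite gcdz_eq0 => /andP[/eqP B0 /eqP D0].
  rewrite dE /disc (expand_det_row _ 0) big1 ?mulr0 ?ltxx // => j _.
  by rewrite !mxE B0 D0; case: j => [[|[|[|//]]] h] /=; rewrite !mul0r.
have [M2 [c [e [n [r2 _]]]]] := reduces_isotropic_row C E F g0.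
have n0 : 0 < n.
  move: d0; rewrite dE (reduces_disc rat r2) disc_adapted; have [_ dM2 _ _] := r2.
  rewrite expr1n mul1r -intrM ltr0z pmulr_rgt0 ?normr_gt0 //.
  by rewrite pmulr_rgt0 // lt_def sqr_ge0 expf_neq0.
have g0' : 0 < gcdz B D by rewrite lt_def g0.
have [m [M3 [n' [n'0 r3]]]] := adapted_reduces c e g0' n0.
exists (1 * 1 * m), (M3 *m (M2 *m M)), n'; split => //.
exact: reduces_trans (reduces_trans r1 r2) r3.
Qed.

(** * Primitive integral points of XY = nZ^2 *)

Lemma qval_std (K : comNzRingType) (n : int) (x y z : K) :
  qval (adapted 1 0 0 n) (row3 x y z) = x * y - n%:~R * z ^+ 2.
Proof. by rewrite qval_adapted; ring. Qed.

Lemma qbil_std (K : numFieldType) (n : int) (x y z x' y' z' : K) :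
  qbil (adapted 1 0 0 n) (row3 x y z) (row3 x' y' z') =
  (x * y' + y * x') / 2 - n%:~R * (z * z').
Proof. by rewrite /qbil row3D !qval_std; field. Qed.

(** The isotropic vector (n s^2, t^2, s t) of XY - nZ^2 in lowest terms: for s
and t coprime the common factor of the entries is gcd(t, n). *)
Definition std_point (n s t : int) : 'rV[int]_3 :=
  row3 (n * s ^+ 2 %/ gcdz t n)%Z (t ^+ 2 %/ gcdz t n)%Z (s * t %/ gcdz t n)%Z.

Lemma std_pointE n s t :
  gcdz t n *: std_point n s t = row3 (n * s ^+ 2) (t ^+ 2) (s * t).
Proof.
rewrite row3Z ![gcdz t n * _]mulrC !divzK //.
- exact: dvdz_mull (dvdz_gcdl t n).
- exact: dvdz_mulr (dvdz_gcdl t n).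
- exact: dvdz_mulr (dvdz_gcdr t n).
Qed.

(** Since gcd(t^2, s t) = t, the content of (n s^2, t^2, s t) is
gcd(n s^2, t) = gcd(n, t). *)
Lemma conicZ_std_point n s t : 0 < n -> coprimez s t ->
  conicZ (adapted 1 0 0 n) (std_point n s t).
Proof.
move=> n0 cst; have g0 : gcdz t n != 0 by rewrite gcdz_eq0 (gt_eqF n0) andbF.
split; last first.
  apply: (mulfI (expf_neq0 2 g0)); rewrite -qvalZ std_pointE qval_std intz; ring.
have := contentZ (gcdz t n) (std_point n s t).
rewrite std_pointE primitive_row3 !abszM.
have /eqP gst : coprime `|s| `|t| by move: cst; rewrite /coprimez /gcdz.
have -> : gcdn (`|t| * `|t|) (`|s| * `|t|) = `|t|%N.
  by rewrite -muln_gcdl gcdnC gst mul1n.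
rewrite gcdnC Gauss_gcdl ?coprimeMr 1?coprime_sym ?/coprime ?gst // => /eqP.
have -> : gcdn `|t| `|n| = `|gcdz t n|%N by [].
by rewrite -[X in X == _]muln1 eqn_pmul2l ?absz_gt0 // eq_sym => /eqP.
Qed.

Lemma std_point_infty n : 0 < n -> std_point n 1 0 = row3 1 0 0.
Proof.
move=> n0; apply: (scale_row_inj (lt0r_neq0 n0)).
have gE : gcdz 0 n = n by rewrite gcd0z gtz0_abs.
by rewrite -[X in X *: _]gE std_pointE row3Z expr1n expr0n /= !mulr0 !mulr1.
Qed.

(** If Y is nonzero, write Z / Y = s / t in lowest terms; then t (X, Y, Z) is a
multiple of (n s^2, t^2, s t), and contents decide the multiple up to sign.
If Y = 0 then Z = 0 and the vector is (1, 0, 0) up to sign, which is the pair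
s = 1, t = 0. The parameters are given as numerator and denominator because
limits superior on the line run over rational numbers. *)
Lemma conicZ_std_inv n v : 0 < n -> conicZ (adapted 1 0 0 n) v ->
  exists s t : int, [/\ coprimez s t,
    t = 0 \/ exists q : rat, s = numq q /\ t = denq q &
    v = std_point n s t \/ v = - std_point n s t].
Proof.
move=> n0 cv; have [pv _] := cv.
move: (cv); rewrite {1}[v]row3_eta; set x := v 0 0; set y := v 0 1; set z := v 0 2.
move=> /conicZ_adapted; rewrite mul1r !mul0r !addr0 => h.
have [y0|y0] := eqVneq y 0.
  have z0 : z = 0.
    by move/esym/eqP: h; rewrite y0 mul0r mulf_eq0 gt_eqF //= sqrf_eq0 => /eqP.
  exists 1, 0; split; [by rewrite /coprimez gcdz0 | by left |].
  rewrite std_point_infty //.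
  have : `|x|%N = 1%N.
    by move: pv; rewrite [v]row3_eta primitive_row3 -/x -/y -/z y0 z0 !gcdn0.
  move=> x1; have /orP[/eqP xE|/eqP xE] : (x == 1) || (x == -1) by lia.
    by left; rewrite [v]row3_eta -/x -/y -/z y0 z0 xE.
  by right; rewrite [v]row3_eta -/x -/y -/z y0 z0 xE -scaleN1r row3Z mulr1 mulr0.
pose q : rat := z%:~R / y%:~R; set s := numq q; set t := denq q.
have t0 : t != 0 by exact: denq_neq0.
have cst : coprimez s t by rewrite /coprimez /gcdz; exact: coprime_num_den.
have zt : z * t = s * y.
  have yq : (y%:~R : rat) != 0 by rewrite intr_eq0.
  by apply/eqP; rewrite -(eqr_int rat) !intrM [s%:~R]numqE /q mulrAC divfK // mulrC.
have /dvdzP[k yE] : (t %| y)%Z.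
  have cts : coprimez t s by rewrite coprimez_sym.
  by rewrite -(Gauss_dvdzr y cts) -zt dvdz_mull.
have zE : z = k * s.
  by apply: (mulIf t0); rewrite zt yE; ring.
have k0 : k != 0 by apply: contra y0; rewrite yE => /eqP->; rewrite mul0r.
have xE : x * t = n * k * s ^+ 2.
  apply: (mulfI k0); rewrite (_ : k * (x * t) = y * x); last by rewrite yE; ring.
  by rewrite h zE; ring.
have vE : t *: v = (k * gcdz t n) *: std_point n s t.
  rewrite -scalerA std_pointE [v]row3_eta -/x -/y -/z !row3Z yE zE.
  by congr row3; rewrite ?[t * x]mulrC ?xE; ring.
exists s, t; split; [by []|by right; exists q|].
have [pstd _] := conicZ_std_point n0 cst.
have := contentZ t v; rewrite vE contentZ pstd pv !muln1 => kt.
have /orP[/eqP tE|/eqP tE] : (k * gcdz t n == t) || (k * gcdz t n == - t).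
  by move: (k * gcdz t n) (t) kt => a b; lia.
  by left; apply: (scale_row_inj t0); rewrite vE tE.
by right; apply: (scale_row_inj t0); rewrite vE tE scaleNr scalerN.
Qed.

(** * Limits superior along families of sets *)

Section limsup.
Local Open Scope ereal_scope.
Local Open Scope classical_set_scope.

(** The sets V and W play the role of neighbourhoods of the two limit points; asking for a
dominating y for each x, rather than for a map between the index types,
allows the several primitive vectors over one rational number. The factor a
absorbs a ratio of the two families that is only asymptotically constant. *)
Lemma limsup_along_le (R : realType) (T U : Type) (F : set_system T) (G : set_system U)
    (f : T -> \bar R) (g : U -> \bar R) (a : R) : (0 < a)%R ->
  (forall V, G V -> exists2 W, F W &
     forall x, W x -> exists2 y, V y & f x <= a%:E * g y) ->
  limsup_along F f <= a%:E * limsup_along G g.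
Proof.
move=> a0 h; rewrite -lee_pdivrMl //; apply: le_ereal_inf_tmp => _ [V GV <-].
rewrite lee_pdivrMl //; have [W FW hW] := h V GV.
apply: le_trans (ereal_inf_lbound _) _; first by exists W.
apply: ge_ereal_sup => _ [x Wx <-]; have [y Vy] := hW x Wx.
move=> /le_trans; apply; rewrite lee_pmul2l // ?lte_fin //.
by apply: ereal_sup_ubound; exists y.
Qed.

(** Lets one compare two limits superior whose terms agree up to a factor
tending to 1. *)
Lemma lee_mul1p (R : realType) (x y : \bar R) :
  (forall e : R, (0 < e)%R -> x <= (1 + e)%:E * y) -> x <= y.
Proof.
case: y => [r| |] h.
- apply/lee_addgt0Pr => e e0; set d := (e / (`|r| + 1))%R.
  have r1 : (0 < `|r| + 1)%R by rewrite ltr_wpDl.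
  have d0 : (0 < d)%R by rewrite divr_gt0.
  apply: le_trans (h d d0) _; rewrite -EFinM -EFinD lee_fin mulrDl mul1r lerD2l.
  rewrite /d mulrAC ler_pdivrMr // ler_pM2l // (le_trans (ler_norm r)) //.
  by rewrite lerDl.
- exact: leey.
- by have := h 1%R ltr01; rewrite gt0_muleNy // lte_fin addr_gt0.
Qed.

(** If both limits superior were below the one of the maximum, two small sets
would witness it, and so would their intersection. *)
Lemma limsup_along_max (R : realType) (T : Type) (F : set_system T) (f g : T -> \bar R) :
  (forall A B, F A -> F B -> F (A `&` B)) ->
  limsup_along F (fun x => maxe (f x) (g x)) =
  maxe (limsup_along F f) (limsup_along F g).
Proof.
move=> FI; apply/eqP; rewrite eq_le; apply/andP; split; last first.
  rewrite ge_max; apply/andP; split; apply: le_ereal_inf_tmp => _ [V FV <-];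
    (apply: le_trans (ereal_inf_lbound _) _; first by exists V);
    apply: ge_ereal_sup => _ [x Vx <-]; apply: le_ereal_sup_tmp;
    exists (maxe (f x) (g x)); rewrite ?le_max ?lexx ?orbT //; by exists x.
rewrite leNgt; apply/negP; rewrite gt_max => /andP[].
move=> /ereal_inf_lt[_ [A FA <-] hA] /ereal_inf_lt[_ [B FB <-] hB].
set L := limsup_along F _ in hA hB *.
suff : L < L by rewrite ltxx.
apply: (@le_lt_trans _ _ (maxe (ereal_sup (f @` A)) (ereal_sup (g @` B)))).
  2: by rewrite gt_max hA.
apply: le_trans (ereal_inf_lbound _) _; first by exists (A `&` B) => //; exact: FI.
apply: ge_ereal_sup => _ [x [Ax Bx] <-]; rewrite ge_max !le_max.
apply/andP; split; apply/orP; [left|right]; apply: ereal_sup_ubound; by exists x.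
Qed.

Lemma limsup_along_bigmax (R : realType) (T : Type) (F : set_system T) (D : seq nat)
    (f : nat -> T -> \bar R) :
  (forall A B, F A -> F B -> F (A `&` B)) -> F setT ->
  limsup_along F (fun x => \big[maxe/-oo]_(d <- D) f d x) =
  \big[maxe/-oo]_(d <- D) limsup_along F (f d).
Proof.
move=> FI FT; elim: D => [|d D IH].
  rewrite big_nil; apply/eqP; rewrite eq_le leNye andbT.
  apply: le_trans (ereal_inf_lbound _) _; first by exists setT.
  by apply: ge_ereal_sup => _ [x _ <-]; rewrite big_nil.
rewrite big_cons -IH -limsup_along_max //; congr limsup_along.
by apply/funext => x; rewrite big_cons.
Qed.

Lemma eq_limsup_along (R : realType) (T U : Type) (F : set_system T) (G : set_system U)
    (f : T -> \bar R) (g : U -> \bar R) :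
  (forall V, G V -> exists2 W, F W & forall x, W x -> exists2 y, V y & f x = g y) ->
  (forall W, F W -> exists2 V, G V & forall y, V y -> exists2 x, W x & g y = f x) ->
  limsup_along F f = limsup_along G g.
Proof.
move=> h1 h2; apply/eqP; rewrite eq_le -[X in _ <= X]mul1e -[X in _ && (_ <= X)]mul1e.
apply/andP; split; apply: limsup_along_le => // V.
  by move=> /h1[W FW hW]; exists W => // x /hW[y Vy ->]; exists y => //; rewrite mul1e.
by move=> /h2[W FW hW]; exists W => // x /hW[y Vy ->]; exists y => //; rewrite mul1e.
Qed.

Lemma rat_nbhsI (R : realType) (xi : R) A B :
  rat_nbhs xi A -> rat_nbhs xi B -> rat_nbhs xi (A `&` B).
Proof.
move=> [U nU hU] [V nV hV]; exists (U `&` V); first exact: filterI.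
by move=> q [Uq Vq]; split; [exact: hU | exact: hV].
Qed.

Lemma rat_nbhsT (R : realType) (xi : R) : rat_nbhs xi setT.
Proof. by exists setT => //; exact: filterT. Qed.

Lemma EFin_div (R : realType) (a b : R) : (b != 0)%R -> a%:E / b%:E = (a / b)%:E.
Proof. by move=> b0; rewrite inver (negbTE b0). Qed.

End limsup.

(** * Trading the gcd for a maximum over divisors *)

(** Multiplying a fraction by d cancels exactly gcd(d, t) from its denominator t. *)
Lemma denq_natmul (d : nat) (q : rat) : (0 < d)%N ->
  denq (d%:R * q) * gcdn d `|denq q| = denq q.
Proof.
move=> d0; set t := denq q; set k := gcdn d `|t|.
have t0 : 0 < t by exact: denq_gt0.
have k0 : (0 < k)%N by rewrite gcdn_gt0 d0.
have kz : k%:Z != 0 by rewrite -lt0n.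
have /dvdzP[d' dE] : (k %| d%:Z)%Z by rewrite dvdzE dvdn_gcdl.
have /dvdzP[t' tE] : (k %| t)%Z by rewrite dvdzE dvdn_gcdr.
have t'0 : 0 < t' by rewrite -(pmulr_lgt0 _ (_ : 0 < k%:Z)) -?tE.
have c1 : coprime `|d' * numq q| `|t'|.
  rewrite abszM coprimeMl; apply/andP; split.
    rewrite /coprime -(eqn_pmul2r k0) mul1n muln_gcdl -[X in gcdn (_ * X) (_ * X)]/(`|k%:Z|%N).
    by rewrite -!abszM -dE -tE.
  by apply: (@coprime_dvdr _ `|t|); [rewrite tE abszM dvdn_mulr | exact: coprime_num_den].
have -> : d%:R * q = (d' * numq q)%:~R / t'%:~R.
  have kq : (k%:~R : rat) != 0 by rewrite intr_eq0.
  have tq : (t'%:~R : rat) != 0 by rewrite intr_eq0 gt_eqF.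
  have dq : (d%:R : rat) = d'%:~R * k%:~R by rewrite -intrM -dE.
  rewrite dq -[q in LHS]divq_num_den -/t tE !intrM.
  by field; rewrite tq.
by rewrite coprimeq_den // gt_eqF // gtr0_norm // tE.
Qed.

Section real_side.
Local Open Scope classical_set_scope.

Lemma rat_nbhs_mul (R : realType) (d : nat) (xi : R) V : (0 < d)%N ->
  rat_nbhs (d%:R * xi) V <-> rat_nbhs xi [set q | V (d%:R * q)].
Proof.
move=> d0; have dR : (d%:R : R) != 0 by rewrite pnatr_eq0 -lt0n.
have dQ : (d%:R : rat) != 0 by rewrite pnatr_eq0 -lt0n.
split=> -[U nU hU].
  exists [set x | U (d%:R * x)].
    have c : {for xi, continuous (fun x : R => d%:R * x)}.
      by apply: cvgM; [exact: cvg_cst | exact: cvg_id].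
    exact: c U nU.
  by move=> q /= Uq; apply: hU; rewrite /= rmorphM /= ratr_nat.
exists [set x | U (d%:R^-1 * x)].
  have c : {for d%:R * xi, continuous (fun x : R => d%:R^-1 * x)}.
    by apply: cvgM; [exact: cvg_cst | exact: cvg_id].
  by apply: c; rewrite mulKf.
move=> q /= Uq; have := hU (d%:R^-1 * q); rewrite /= mulVKf //; apply.
by rewrite rmorphM fmorphV /= ratr_nat.
Qed.

(** Multiplication by d is a homeomorphism permuting the rational numbers, so the
limit superior at d xi can be taken along the rationals near xi. All the
divisors then share one filter. *)
Lemma lambda_real_mul (R : realType) (d : nat) (xi : R) : (0 < d)%N ->
  lambda_real (d%:R * xi) = limsup_along (rat_nbhs xi) (fun q : rat =>
    (1 / ((denq (d%:R * q))%:~R ^+ 2 * `|ratr (d%:R * q) - d%:R * xi|)%R%:E)%E).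
Proof.
move=> d0; have dQ : (d%:R : rat) != 0 by rewrite pnatr_eq0 -lt0n.
apply: eq_limsup_along => [V nV|W nW].
  exists [set q | V (d%:R^-1 * q)].
    by apply/(rat_nbhs_mul xi _ d0); rewrite /= (_ : [set q | _] = V) //;
      apply/funext => q /=; rewrite mulKf.
  by move=> q Vq; exists (d%:R^-1 * q); rewrite // mulVKf.
exists [set q | W (d%:R * q)]; first by apply/(rat_nbhs_mul xi _ d0).
by move=> q Wq; exists (d%:R * q).
Qed.

Lemma lambda_term (R : realType) (xi : R) (q : rat) (a : R) : xi != ratr q ->
  (a%:E / ((denq q)%:~R ^+ 2 * `|ratr q - xi|)%R%:E)%E =
  (a / ((denq q)%:~R ^+ 2 * `|ratr q - xi|))%:E.
Proof.
move=> xq; rewrite EFin_div // mulf_neq0 //.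
  by rewrite expf_neq0 // intr_eq0 denq_neq0.
by rewrite normr_eq0 subr_eq0 eq_sym.
Qed.

(** For each rational number s/t the term with the gcd is the maximum over d of
the terms for d xi at d s/t; maxima over a finite index set commute with
limits superior. *)
Lemma lambda_gcd_max (R : realType) (n : int) (xi : R) : 0 < n ->
  (forall q : rat, xi != ratr q) ->
  lambda_gcd n xi = max_divisors n (fun d => lambda_real (d * xi)).
Proof.
move=> n0 irr; have n0' : (0 < `|n|)%N by rewrite absz_gt0 gt_eqF.
pose F (d : nat) (q : rat) : \bar R :=
  (1 / ((denq (d%:R * q))%:~R ^+ 2 * `|ratr (d%:R * q) - d%:R * xi|)%R%:E)%E.
transitivity (\big[maxe/-oo%E]_(d <- divisors `|n|) limsup_along (rat_nbhs xi) (F d)); last first.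
  apply: eq_big_seq => d; rewrite -dvdn_divisors // => dn.
  by rewrite lambda_real_mul // (dvdn_gt0 n0' dn).
rewrite -limsup_along_bigmax; [|exact: rat_nbhsI|exact: rat_nbhsT].
congr limsup_along; apply/funext => q; rewrite lambda_term //.
have FE (d : nat) : (0 < d)%N -> F d q =
    ((gcdn d `|denq q|)%:R ^+ 2 / d%:R / ((denq q)%:~R ^+ 2 * `|ratr q - xi|))%:E.
  move=> d0; have dR : (d%:R : R) != 0 by rewrite pnatr_eq0 -lt0n.
  rewrite /F lambda_term; last first.
    by rewrite rmorphM /= ratr_nat (inj_eq (mulfI dR)).
  rewrite rmorphM /= ratr_nat -mulrBr normrM normr_nat.
  set k := gcdn _ _; rewrite -(denq_natmul q d0) -/k intrM.
  set t := denq (d%:R * q); set x := `|_ - _|.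
  have x0 : x != 0 by rewrite normr_eq0 subr_eq0 eq_sym.
  have t0 : (t%:~R : R) != 0 by rewrite intr_eq0 denq_neq0.
  have k0 : (k%:R : R) != 0 by rewrite pnatr_eq0 -lt0n gcdn_gt0 d0.
  have -> : (Posz k)%:~R = k%:R :> R by [].
  by congr EFin; field; rewrite ?dR ?k0 ?t0 ?x0.
have D0 : 0 < (denq q)%:~R ^+ 2 * `|ratr q - xi|.
  by rewrite mulr_gt0 ?exprn_gt0 ?ltr0z ?denq_gt0 // normr_gt0 subr_eq0 eq_sym.
apply/eqP; rewrite eq_le; apply/andP; split.
  (* The maximum is attained at d = gcd(t, n). *)
  have dn : gcdn `|denq q| `|n| \in divisors `|n| by rewrite -dvdn_divisors // dvdn_gcdr.
  apply: (@bigmax_sup_seq _ _ _ _ _ _ xpredT _ _ dn isT).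
  have g0 : (0 < gcdn `|denq q| `|n|)%N by rewrite gcdn_gt0 n0' orbT.
  rewrite FE // (gcdn_idPl (dvdn_gcdl _ _)) expr2 mulfK ?lexx //.
  by rewrite pnatr_eq0 -lt0n.
rewrite big_seq; apply: bigmax_le => [|d]; first exact: leNye.
rewrite -dvdn_divisors // => dn; have d0 := dvdn_gt0 n0' dn.
rewrite FE // lee_fin ler_pM2r ?invr_gt0 // ler_pdivrMr ?ltr0n // -natrX.
have -> : (gcdz (denq q) n)%:~R = (gcdn `|denq q| `|n|)%:R :> R by [].
rewrite -natrM ler_nat -mulnn leq_mul //.
  by rewrite dvdn_leq ?gcdn_gt0 ?n0' ?orbT // dvdn_gcd dvdn_gcdr (dvdn_trans (dvdn_gcdl _ _) dn).
by rewrite dvdn_leq // dvdn_gcdl.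
Qed.

Lemma lee_div_den (R : realType) (a b c : R) : 0 <= a -> a <= b -> 0 <= c ->
  (a%:E / c%:E <= b%:E / c%:E)%E.
Proof.
move=> a0 ab c0; apply: lee_wpmul2r; last by rewrite lee_fin.
by rewrite inve_ge0 lee_fin.
Qed.

(** The term of d xi, d xi' at (s, t) has the denominator of the term of xi, xi'
at (s, d t), and d divides gcd(d t, n); conversely a pair (s, t) comes from
(s, t / d) with d = gcd(t, n). *)
Lemma mu_gcd_max (R : realType) (n : int) (xi xi' : R) : 0 < n ->
  mu_gcd n xi xi' = max_divisors n (fun d => mu_real (d * xi) (d * xi')).
Proof.
rewrite /max_divisors.
move=> n0; have n0' : (0 < `|n|)%N by rewrite absz_gt0 gt_eqF.
have numE (d : nat) : `|d%:R * xi - d%:R * xi'| = d%:R * `|xi - xi'|.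
  by rewrite -mulrBr normrM normr_nat.
apply/eqP; rewrite eq_le; apply/andP; split.
  apply: ge_ereal_sup => _ [[s t] /= p0 <-].
  set d := gcdn `|t| `|n|.
  have dn : d \in divisors `|n| by rewrite -dvdn_divisors // dvdn_gcdr.
  have d0 : (0 < d)%N by rewrite gcdn_gt0 n0' orbT.
  apply: (@bigmax_sup_seq _ _ _ _ _ d) => //.
  have /dvdzP[t' tE] : (d %| t)%Z by rewrite dvdzE dvdn_gcdl.
  apply: ereal_sup_ubound; exists (s, t') => /=.
    by apply: contra p0 => /eqP[-> t'0]; rewrite tE t'0 mul0r.
  have gE : (gcdz t n)%:~R = d%:R :> R by [].
  by rewrite numE mulrC gE tE intrM -!mulrA.
rewrite big_seq; apply: bigmax_le => [|d]; first exact: leNye.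
rewrite -dvdn_divisors // => dn; have d0 := dvdn_gt0 n0' dn.
apply: ge_ereal_sup => _ [[s t] /= p0 <-].
apply: le_ereal_sup_tmp; eexists; first exists (s, t * d%:Z) => //=.
  have dz : d%:Z != 0 by rewrite -lt0n.
  by apply: contra p0 => /eqP[-> /eqP]; rewrite mulf_eq0 (negPf dz) orbF => /eqP->.
rewrite numE intrM !mulrA; apply: lee_div_den; rewrite ?mulr_ge0 //.
rewrite mulrC ler_wpM2l // -[d%:R]/(d%:Z%:~R) ler_int lez_nat.
by rewrite dvdn_leq ?gcdn_gt0 ?n0' ?orbT // dvdn_gcd dn abszM dvdn_mull.
Qed.
End real_side.

(** * The approximation ratio at a tangent point *)

Lemma unitmx_intr (K : numFieldType) (M : 'M[int]_3) : \det M != 0 ->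
  map_mx intr M \in (unitmx : pred 'M[K]_3).
Proof. by move=> d0; rewrite unitmxE det_map_mx unitfE intr_eq0. Qed.

Lemma qbilN (K : numFieldType) Phi (P Q : 'rV[K]_3) : qbil Phi P (- Q) = - qbil Phi P Q.
Proof. by rewrite !qbilE linearN mulmxN mxE. Qed.

Lemma conic_ratioN (R : realType) Phi (Sigma : 'rV[R]_3) P :
  conic_ratio Phi Sigma (- P) = conic_ratio Phi Sigma P.
Proof. by rewrite /conic_ratio map_mxN qbilN normrN. Qed.

Lemma gcdz_gt0 (t n : int) : 0 < n -> 0 < gcdz t n.
Proof. by move=> n0; rewrite lt_def gcdz_eq0 (gt_eqF n0) andbF. Qed.

Lemma map_std_point (K : numFieldType) (n s t : int) : 0 < n ->
  map_mx intr (std_point n s t) =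
  (gcdz t n)%:~R^-1 *: row3 (n%:~R * s%:~R ^+ 2) (t%:~R ^+ 2) (s%:~R * t%:~R) :> 'rV[K]_3.
Proof.
move=> n0; have g0 : (gcdz t n)%:~R != 0 :> K by rewrite intr_eq0 gt_eqF // gcdz_gt0.
apply: (scalerI g0); rewrite scalerA divff // scale1r -map_mxZ std_pointE map_row3.
by rewrite !(rmorphM, rmorphXn).
Qed.

Section conic_side.
Variables (R : realType) (m n : int) (M : 'M[int]_3) (Phi : tqf).
Hypothesis n0 : 0 < n.
Hypothesis rM : reduces m M Phi (adapted 1 0 0 n).

Let MR : 'M[R]_3 := map_mx intr M.

(** The form takes the value - n (z - xi y)^2 at Sigma, and its polar form
pairs Sigma with (n s^2, t^2, s t) to n/2 times
(s - t xi) (y (s + t xi) - 2 z t). The scaling m |det M| and the discriminant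
m^3 |det M| n combine to the single factor m. *)
Lemma conic_ratio_std (xi y z : R) (s t : int) :
  s%:~R - t%:~R * xi != 0 -> y * (s%:~R + t%:~R * xi) - 2 * z * t%:~R != 0 ->
  conic_ratio Phi (row3 (2 * n%:~R * xi * z - n%:~R * xi ^+ 2 * y) y z *m MR)
    (std_point n s t *m M) =
  (m%:~R * (gcdz t n)%:~R * (2 * `|z - xi * y|) /
   (`|s%:~R - t%:~R * xi| * `|y * (s%:~R + t%:~R * xi) - 2 * z * t%:~R|))%:E.
Proof.
move=> a0 b0; set sg := row3 _ _ _.
have [m0 d0 hq _] := rM.
have dl0 : 0 < (`|\det M|)%:~R :> R by rewrite ltr0z normr_gt0.
have mR : 0 < m%:~R :> R by rewrite ltr0z.
have nR : 0 < n%:~R :> R by rewrite ltr0z.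
have gR : 0 < (gcdz t n)%:~R :> R by rewrite ltr0z gcdz_gt0.
have qE : qval (adapted 1 0 0 n) sg = - (n%:~R * (z - xi * y) ^+ 2).
  by rewrite qval_std; ring.
have bE : qbil (adapted 1 0 0 n) sg (map_mx intr (std_point n s t)) =
    n%:~R / (2 * (gcdz t n)%:~R) *
    ((s%:~R - t%:~R * xi) * (y * (s%:~R + t%:~R * xi) - 2 * z * t%:~R)).
  rewrite map_std_point // row3Z qbil_std; field; exact: lt0r_neq0.
have dE : disc R Phi = m%:~R ^+ 3 * (`|\det M|)%:~R * n%:~R.
  by rewrite (reduces_disc R rM) disc_adapted expr1n mul1r !(rmorphM, rmorphXn).
rewrite /conic_ratio map_mxM (reduces_qbil _ _ rM) bE hq qE dE [(m * _)%:~R]intrM.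
set A := s%:~R - _ in a0 *; set B := y * _ - _ in b0 *; set C := z - _.
set dl := (`|\det M|)%:~R in dl0 *; set g := (gcdz t n)%:~R in gR *.
have -> : Num.sqrt (m%:~R ^+ 3 * dl * (n%:~R) * `|m%:~R * dl * - (n%:~R * C ^+ 2)|) =
    m%:~R ^+ 2 * dl * n%:~R * `|C| :> R.
  have -> : m%:~R ^+ 3 * dl * (n%:~R) * `|m%:~R * dl * - (n%:~R * C ^+ 2)| =
      (m%:~R ^+ 2 * dl * n%:~R * C) ^+ 2 :> R.
    rewrite normrM normrN (ger0_norm (mulr_ge0 (ltW mR) (ltW dl0))).
    by rewrite (ger0_norm (mulr_ge0 (ltW nR) (sqr_ge0 C))); ring.
  by rewrite sqrtr_sqr normrM gtr0_norm // !mulr_gt0 ?exprn_gt0.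
rewrite !normrM !(gtr0_norm mR) !(gtr0_norm dl0) (gtr0_norm nR) gtr0_norm ?invr_gt0 ?mulr_gt0 //.
have nA : `|A| != 0 by rewrite normr_eq0.
have nB : `|B| != 0 by rewrite normr_eq0.
have [mN dN nN gN] := And4 (lt0r_neq0 mR) (lt0r_neq0 dl0) (lt0r_neq0 nR) (lt0r_neq0 gR).
rewrite EFin_div ?mulf_neq0 ?invr_neq0 ?mulf_neq0 //.
by congr EFin; field; rewrite ?mN ?dN ?nN ?gN ?nA ?nB.
Qed.

End conic_side.

(** * The parametrization by the projective line *)

Definition row2 (T : nzRingType) (x y : T) : 'rV[T]_2 := \row_(j < 2) [:: x; y]`_j.

Lemma row2_eta (T : nzRingType) (v : 'rV[T]_2) : v = row2 (v 0 0) (v 0 1).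
Proof.
by apply/rowP => j; rewrite mxE; case: j => [[|[|//]] h] /=;
  congr (v 0 _); apply: val_inj.
Qed.

Lemma row2Z (T : nzRingType) (k x y : T) : k *: row2 x y = row2 (k * x) (k * y).
Proof. by rewrite [LHS]row2_eta !mxE. Qed.

Lemma row2_eq0 (T : nzRingType) (x y : T) : (row2 x y == 0) = (x == 0) && (y == 0).
Proof.
apply/eqP/andP => [/rowP h|[/eqP-> /eqP->]].
  by move: (h 0) (h 1); rewrite !mxE /= => -> ->.
by rewrite [LHS]row2_eta [RHS]row2_eta !mxE.
Qed.

Definition affine_curve (K : nzRingType) (n : int) (xi : K) : 'rV[K]_3 :=
  row3 (n%:~R * xi ^+ 2) 1 xi.

Section parametrization.
Variables (m n : int) (M : 'M[int]_3) (Phi : tqf).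
Hypothesis n0 : 0 < n.
Hypothesis rM : reduces m M Phi (adapted 1 0 0 n).

(** On XY = nZ^2 the pairs [Z : Y] and [X : nZ] agree where both are defined; the
second is needed only at Y = 0, where Z vanishes as well. *)
Definition std_coord (K : numFieldType) (u : 'rV[K]_3) : 'rV[K]_2 :=
  if u 0 1 != 0 then row2 (u 0 2) (u 0 1) else row2 (u 0 0) 0.

Definition std_curve (K : numFieldType) (v : 'rV[K]_2) : 'rV[K]_3 :=
  row3 (n%:~R * v 0 0 ^+ 2) (v 0 1 ^+ 2) (v 0 0 * v 0 1).

Definition to_line (K : numFieldType) (x : 'rV[K]_3) : 'rV[K]_2 :=
  std_coord (x *m invmx (map_mx intr M)).

Definition of_line (K : numFieldType) (v : 'rV[K]_2) : 'rV[K]_3 :=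
  std_curve v *m map_mx intr M.

Lemma unit_M (K : numFieldType) : map_mx intr M \in (unitmx : pred 'M[K]_3).
Proof. by case: rM => _ d0 _ _; exact: unitmx_intr. Qed.

Lemma conic_pull (K : numFieldType) (x : 'rV[K]_3) : conic Phi x ->
  let u := x *m invmx (map_mx intr M) in u 0 0 * u 0 1 = n%:~R * u 0 2 ^+ 2.
Proof.
case: rM => m0 d0 hq _ /= qx; set u := x *m _.
have : qval Phi (u *m map_mx intr M) = 0 by rewrite mulmxKV ?unit_M.
rewrite hq => /eqP; rewrite mulf_eq0 intr_eq0 mulf_eq0 gt_eqF // normr_eq0 (negPf d0) /=.
by rewrite {1}[u]row3_eta qval_std subr_eq0 => /eqP.
Qed.

Lemma conic_push (K : numFieldType) (u : 'rV[K]_3) :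
  u 0 0 * u 0 1 = n%:~R * u 0 2 ^+ 2 -> conic Phi (u *m map_mx intr M).
Proof.
case: rM => _ _ hq _ h; rewrite /conic /= hq [u]row3_eta qval_std h; ring.
Qed.

Lemma mulM_eq0 (K : numFieldType) (u : 'rV[K]_3) :
  (u *m map_mx intr M == 0) = (u == 0).
Proof.
apply/eqP/eqP => [h|->]; last by rewrite mul0mx.
by rewrite -(mulmxK (unit_M K) u) h mul0mx.
Qed.

Lemma mulVM_eq0 (K : numFieldType) (u : 'rV[K]_3) :
  (u *m invmx (map_mx intr M) == 0) = (u == 0).
Proof. by rewrite -[LHS]mulM_eq0 mulmxKV ?unit_M. Qed.

Lemma std_coord_neq0 (K : numFieldType) (u : 'rV[K]_3) : u != 0 ->
  u 0 0 * u 0 1 = n%:~R * u 0 2 ^+ 2 -> std_coord u != 0.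
Proof.
rewrite {1}[u]row3_eta row3_eq0 /std_coord => u0 h.
case: ifPn => [y0|]; first by rewrite row2_eq0 negb_and y0 orbT.
rewrite negbK => /eqP y0; rewrite row2_eq0 eqxx andbT.
move: h u0; rewrite y0 mulr0 eqxx => /esym/eqP.
by rewrite mulf_eq0 intr_eq0 gt_eqF //= sqrf_eq0 => /eqP ->; rewrite eqxx andbT.
Qed.

Lemma std_curveK (K : numFieldType) (v : 'rV[K]_2) : v != 0 ->
  proj_eq (std_coord (std_curve v)) v.
Proof.
rewrite [v]row2_eta row2_eq0 /std_coord /std_curve !mxE /= => v0.
have [t0|t0] := eqVneq (v 0 1) 0.
  rewrite t0 expr0n eqxx /= in v0 *; rewrite andbT in v0.
  exists (n%:~R * v 0 0); first by rewrite mulf_neq0 // intr_eq0 gt_eqF.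
  by rewrite row2Z mulr0; congr row2; ring.
rewrite expf_neq0 //; exists (v 0 1) => //.
by rewrite row2Z; congr row2; ring.
Qed.

Lemma std_coordK (K : numFieldType) (u : 'rV[K]_3) : u != 0 ->
  u 0 0 * u 0 1 = n%:~R * u 0 2 ^+ 2 -> proj_eq (std_curve (std_coord u)) u.
Proof.
move=> u0 h; rewrite /std_coord; case: ifPn => [y0|].
  exists (u 0 1) => //; rewrite [in RHS](row3_eta u) row3Z /std_curve !mxE /=.
  by congr row3; [rewrite -h mulrC | rewrite mulrC].
rewrite negbK => /eqP y0.
have z0 : u 0 2 = 0.
  move/esym/eqP: h; rewrite y0 mulr0 mulf_eq0 intr_eq0 gt_eqF //= sqrf_eq0.
  by move/eqP.
have x0 : u 0 0 != 0 by move: u0; rewrite {1}[u]row3_eta row3_eq0 y0 z0 eqxx !andbT.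
exists (n%:~R * u 0 0); first by rewrite mulf_neq0 // intr_eq0 gt_eqF.
rewrite [in RHS](row3_eta u) y0 z0 row3Z /std_curve !mxE /=.
by congr row3; ring.
Qed.

Definition linear_form (a : nat) (c : 'I_a -> rat) : mpoly a rat :=
  \sum_(k < a) c k *: mpolyX rat (mnm1 k).

Lemma linear_form_homog (a : nat) (c : 'I_a -> rat) :
  linear_form c \is ishomog1 1 mdeg.
Proof.
apply: rpred_sum => k _; apply: rpredZ; rewrite dhomogX; apply/eqP; exact: mdeg1.
Qed.

Lemma linear_formE (K : numFieldType) (a : nat) (c : 'I_a -> rat) (h : 'I_a -> K) :
  mmap (@ratr K) h (linear_form c) = \sum_(k < a) ratr (c k) * h k.
Proof.
by rewrite /linear_form raddf_sum; apply: eq_bigr => k _; rewrite /= mmapZ mmapX mmap1U.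
Qed.

Lemma linear_forms_regular (K : numFieldType) (b : nat) (C : 'M[rat]_(3, b)) :
  exists G : 'I_b -> mpoly 3 rat, (forall i, G i \is ishomog1 1 mdeg) /\
    forall x : 'rV[K]_3, eval_forms G x = x *m map_mx ratr C.
Proof.
exists (fun i => linear_form (fun k => C k i)); split=> [i|x].
  exact: linear_form_homog.
apply/rowP => i; rewrite !mxE linear_formE; apply: eq_bigr => k _.
by rewrite mxE mulrC.
Qed.

Lemma map_invM (K : numFieldType) :
  invmx (map_mx intr M) = map_mx ratr (invmx (map_mx intr M)) :> 'M[K]_3.
Proof.
rewrite map_invmx; congr invmx; apply/matrixP => i j.
by rewrite !mxE /= ratr_int.
Qed.

(** The charts [Z : Y] and [X : nZ] cover the conic, and the inverse of M has
rational entries. *)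
Lemma to_line_regular (K : numClosedFieldType) :
  regular_map_over_Q (conic Phi) [set: 'rV[K]_2] (@to_line K).
Proof.
move=> x cx x0; split => //.
  by apply: std_coord_neq0; [rewrite mulVM_eq0 | exact: conic_pull].
(* Matrices of the charts [Z : Y] and [X : nZ]. *)
pose S1 : 'M[rat]_(3, 2) :=
  \matrix_(i, j) ((i == 2) && (j == 0) || (i == 1) && (j == 1))%:R.
pose S2 : 'M[rat]_(3, 2) :=
  \matrix_(i, j) (((i == 0) && (j == 0))%:R + n%:~R * ((i == 2) && (j == 1))%:R).
have S1E (u : 'rV[K]_3) : u *m map_mx ratr S1 = row2 (u 0 2) (u 0 1).
  rewrite [LHS]row2_eta !mxE !big_ord_recl !big_ord0 !mxE /=.
  rewrite rmorph0 rmorph1 !(mulr0, mulr1, add0r, addr0).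
  by congr row2; congr (u 0 _); apply: val_inj.
have S2E (u : 'rV[K]_3) : u *m map_mx ratr S2 = row2 (u 0 0) (n%:~R * u 0 2).
  rewrite [LHS]row2_eta !mxE !big_ord_recl !big_ord0 !mxE /=.
  rewrite !(mulr0, mulr1, add0r, addr0) rmorph0 rmorph1 ratr_int.
  rewrite !(mulr0, mulr1, add0r, addr0) mulrC.
  by congr row2; congr (_ * u 0 _); apply: val_inj.
set u := x *m invmx (map_mx intr M).
have [y0|y0] := eqVneq (u 0 1) 0.
  have [G [hG GE]] := linear_forms_regular K (invmx (map_mx intr M) *m S2).
  have GE' (y : 'rV[K]_3) : eval_forms G y = (y *m invmx (map_mx intr M)) *m map_mx ratr S2.
    by rewrite GE map_mxM -map_invM mulmxA.
  exists 1, G; split=> //.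
    rewrite GE' S2E row2_eq0 negb_and.
    have := std_coord_neq0 (_ : u != 0) (conic_pull cx).
    rewrite mulVM_eq0 => /(_ x0); rewrite /std_coord y0 eqxx /= row2_eq0 eqxx andbT => ->.
    by [].
  move=> y cy y0'; rewrite GE' S2E /to_line /std_coord; set v := y *m _ => nz.
  have hv : v 0 0 * v 0 1 = n%:~R * v 0 2 ^+ 2 by exact: conic_pull.
  have nK : n%:~R != 0 :> K by rewrite intr_eq0 gt_eqF.
  case: ifPn => [v1|]; last first.
    rewrite negbK => /eqP v1; move/esym/eqP: hv; rewrite v1 mulr0 mulf_eq0 (negPf nK) /=.
    by rewrite sqrf_eq0 => /eqP ->; rewrite mulr0; exists 1; rewrite ?oner_eq0 // scale1r.
  have v2 : v 0 2 != 0.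
    apply: contra nz => /eqP v2; move/eqP: hv.
    rewrite v2 expr0n mulr0 mulf_eq0 (negPf v1) orbF => /eqP ->.
    by rewrite row2_eq0 eqxx.
  exists (v 0 1 / (n%:~R * v 0 2)); first by rewrite mulf_neq0 // invr_neq0 // mulf_neq0.
  have v0E : v 0 0 = n%:~R * v 0 2 ^+ 2 / v 0 1 by rewrite -hv mulfK.
  rewrite row2Z v0E; congr row2; field; rewrite ?v1 ?v2 ?nK //.
have [G [hG GE]] := linear_forms_regular K (invmx (map_mx intr M) *m S1).
have GE' (y : 'rV[K]_3) : eval_forms G y = (y *m invmx (map_mx intr M)) *m map_mx ratr S1.
  by rewrite GE map_mxM -map_invM mulmxA.
exists 1, G; split=> //.
  by rewrite GE' S1E row2_eq0 negb_and y0 orbT.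
move=> y cy y0'; rewrite GE' S1E /to_line /std_coord; set v := y *m _ => nz.
have hv : v 0 0 * v 0 1 = n%:~R * v 0 2 ^+ 2 by exact: conic_pull.
have nK : n%:~R != 0 :> K by rewrite intr_eq0 gt_eqF.
have v1 : v 0 1 != 0.
  apply: contra nz => /eqP v1; move/esym/eqP: hv; rewrite v1 mulr0 mulf_eq0 (negPf nK) /=.
  by rewrite sqrf_eq0 => /eqP ->; rewrite row2_eq0 eqxx.
by rewrite v1; exists 1; rewrite ?oner_eq0 // scale1r.
Qed.

Lemma of_line_regular (K : numClosedFieldType) :
  regular_map_over_Q [set: 'rV[K]_2] (conic Phi) (@of_line K).
Proof.
move=> v _ v0.
have cv (w : 'rV[K]_2) : w != 0 -> of_line w != 0.
  rewrite [w]row2_eta row2_eq0 mulM_eq0 row3_eq0 !mxE /= => w0; apply: contra w0.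
  rewrite !sqrf_eq0 mulf_eq0 intr_eq0 gt_eqF //= sqrf_eq0.
  by case/and3P => -> ->.
pose X i : mpoly 2 rat := mpolyX rat (mnm1 i).
pose F : 'rV[mpoly 2 rat]_3 := row3 (n%:~R *: (X 0 * X 0)) (X 1 * X 1) (X 0 * X 1).
pose G (i : 'I_3) : mpoly 2 rat := \sum_(k < 3) (M k i)%:~R *: F 0 k.
have X1 i : X i \is ishomog1 1 mdeg by rewrite dhomogX; apply/eqP; exact: mdeg1.
have X2 i j : X i * X j \is ishomog1 2 mdeg by exact: (dhomogM (X1 i) (X1 j)).
have F2 k : F 0 k \is ishomog1 2 mdeg.
  by rewrite mxE; case: k => [[|[|[|//]]] hk] //=; apply: rpredZ.
have XE (w : 'rV[K]_2) i : mmap (@ratr K) (fun j => w 0 j) (X i) = w 0 i.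
  by rewrite mmapX mmap1U.
have FE (w : 'rV[K]_2) k : mmap (@ratr K) (fun j => w 0 j) (F 0 k) = std_curve w 0 k.
  rewrite !mxE; case: k => [[|[|[|//]]] hk] /=; rewrite ?mmapZ rmorphM /= !XE //.
  by rewrite /= ratr_int.
have GE (w : 'rV[K]_2) : eval_forms G w = of_line w.
  apply/rowP => i; rewrite [LHS]mxE /of_line [RHS]mxE raddf_sum; apply: eq_bigr => k _.
  by rewrite /= mmapZ FE /= ratr_int [map_mx _ _ _ _]mxE mulrC.
split; [| exact: cv |].
  by apply: conic_push; rewrite !mxE /=; ring.
exists 2, G; split; [| by rewrite GE; exact: cv |].
  by move=> i; apply: rpred_sum => k _; exact: rpredZ.
by move=> w _ w0 _; rewrite GE; exists 1; rewrite ?oner_eq0 // scale1r.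
Qed.

Lemma proj_eqZ (K : numFieldType) (u v : 'rV[K]_3) :
  proj_eq u v -> proj_eq (u *m map_mx intr M) (v *m map_mx intr M).
Proof. by case=> c c0 ->; exists c; rewrite // scalemxAl. Qed.

Lemma to_line_parametrization (R : realType) : parametrization Phi (@to_line R[i]).
Proof.
split; first exact: to_line_regular.
exists (@of_line R[i]); split; first exact: of_line_regular.
  move=> x cx x0; rewrite -[x in proj_eq _ x](mulmxKV (unit_M _)).
  by apply/proj_eqZ/std_coordK; [rewrite mulVM_eq0 | exact: conic_pull].
by move=> y _ y0; rewrite /to_line /of_line mulmxK ?unit_M //; exact: std_curveK.
Qed.

(** Over the complex numbers, having a finite coordinate excludes Y = 0 and gives
Z = xi Y; both are relations between real numbers. *)
Lemma to_line_coordinate (R : realType) (Xi : 'rV[R]_3) (xi : R) :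
  conic Phi Xi -> has_coordinate (@to_line R[i]) Xi xi ->
  exists2 c : R, c != 0 &
    Xi = c *: (affine_curve n xi *m map_mx intr M).
Proof.
move=> cXi; rewrite /has_coordinate /to_line.
set w := Xi *m invmx (map_mx intr M).
have -> : map_mx (real_complex R) Xi *m invmx (map_mx intr M) = map_mx (real_complex R) w.
  rewrite /w map_mxM map_invmx; congr (_ *m invmx _).
  by apply/matrixP => i j; rewrite !mxE rmorph_int.
have -> : map_mx (real_complex R) (\row_(j < 2) [:: xi; 1]`_j) = row2 (real_complex R xi) 1.
  by rewrite [LHS]row2_eta !mxE rmorph1.
have hw := conic_pull cXi; rewrite /= -/w in hw.
have XiE := mulmxKV (unit_M R) Xi; rewrite -/w in XiE.
clearbody w; case=> k k0; rewrite /std_coord row2Z mulr1 ![map_mx _ w _ _]mxE.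
have [w1|w1] := eqVneq (w 0 1) 0.
  rewrite w1 rmorph0 eqxx /= => /rowP/(_ 1); rewrite !mxE /= => k00.
  by rewrite -k00 eqxx in k0.
rewrite (fmorph_eq0 (real_complex R)) w1 => /rowP h.
have := h 1; rewrite !mxE /= => kE; have := h 0; rewrite !mxE /= -kE -rmorphM /=.
move=> /(fmorph_inj (real_complex R)) w2.
exists (w 0 1) => //; rewrite scalemxAl row3Z -[LHS]XiE.
congr (_ *m _); rewrite {1}[w]row3_eta w2 mulr1; congr row3.
by apply: (mulIf w1); rewrite hw w2; ring.
Qed.
End parametrization.

(** * Approximability on the conic and on the line *)

Lemma irrational_sub_neq0 (R : realType) (xi : R) (s t : int) :
  (forall q : rat, xi != ratr q) -> (s, t) != (0, 0) -> s%:~R - t%:~R * xi != 0.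
Proof.
move=> irr st; have [t0|t0] := eqVneq t 0.
  by move: st; rewrite t0 mul0r subr0 xpair_eqE eqxx andbT intr_eq0.
have tR : t%:~R != 0 :> R by rewrite intr_eq0.
rewrite subr_eq0; apply: contra (irr (s%:~R / t%:~R)) => /eqP h.
by rewrite rmorphM fmorphV /= !ratr_int h mulrAC mulfV // mul1r.
Qed.

Section approximation.
Local Open Scope classical_set_scope.
Variables (R : realType) (m n : int) (M : 'M[int]_3) (Phi : tqf).
Hypothesis n0 : 0 < n.
Hypothesis rM : reduces m M Phi (adapted 1 0 0 n).

Let MR : 'M[R]_3 := map_mx intr M.
Let uMR : MR \in unitmx := unit_M rM R.

(** A rational coordinate would give a rational point, M being rational. *)
Lemma irrational_coordinate (Xi : 'rV[R]_3) (c xi : R) : c != 0 ->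
  Xi = c *: (affine_curve n xi *m MR) -> ~ rational_point Phi Xi ->
  forall q : rat, xi != ratr q.
Proof.
move=> c0 XiE irr q; apply/eqP => xiq; apply: irr.
exists (row3 (n%:~R * q ^+ 2) 1 q *m map_mx intr M).
  split; first by rewrite (mulM_eq0 rM) row3_eq0 oner_eq0 andbF.
  by apply: (conic_push rM); rewrite !mxE /=; ring.
exists c => //; rewrite XiE xiq map_mxM map_row3 rmorphM rmorphXn rmorph1 /= ratr_int.
congr (_ *: (_ *m _)); apply/matrixP => i j; by rewrite !mxE /= ratr_int.
Qed.

(** The tangent line at (n xi^2, 1, xi) is x + n xi^2 y = 2 n xi z, which
determines x from y and z. *)
Lemma tangent_coordinates (Xi Sigma : 'rV[R]_3) (c xi : R) : c != 0 ->
  Xi = c *: (affine_curve n xi *m MR) -> on_tangent Phi Xi Sigma ->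
  exists y z : R,
    Sigma = row3 (2 * n%:~R * xi * z - n%:~R * xi ^+ 2 * y) y z *m MR.
Proof.
move=> c0 XiE [_ tS]; set sg := Sigma *m invmx MR.
have SE : Sigma = sg *m MR by rewrite mulmxKV.
have [m0 d0 _ _] := rM.
have kR : (m * `|\det M|)%:~R != 0 :> R.
  by rewrite intr_eq0 mulf_neq0 ?normr_eq0 // gt_eqF.
move: tS; rewrite XiE SE scalemxAl (reduces_qbil _ _ rM) => /eqP.
rewrite mulf_eq0 (negPf kR) /= {1}[sg]row3_eta row3Z qbil_std => /eqP h.
exists (sg 0 1), (sg 0 2); congr (_ *m _); rewrite {1}[sg]row3_eta; congr row3.
by apply: (mulfI c0); lra.
Qed.

(** When z = xi y the point Sigma is y times (n xi^2, 1, xi). *)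
Lemma tangent_nondegenerate (Xi Sigma : 'rV[R]_3) (c xi y z : R) : c != 0 ->
  Xi = c *: (affine_curve n xi *m MR) -> Sigma != 0 ->
  Sigma = row3 (2 * n%:~R * xi * z - n%:~R * xi ^+ 2 * y) y z *m MR ->
  ~ proj_eq Sigma Xi -> z - xi * y != 0.
Proof.
move=> c0 XiE S0 SE np; apply/eqP => zE; apply: np.
have {}zE : z = xi * y by apply/eqP; rewrite -subr_eq0 zE.
have SE' : Sigma = y *: (affine_curve n xi *m MR).
  by rewrite SE scalemxAl row3Z zE; congr (row3 _ _ _ *m _); ring.
have y0 : y != 0 by apply: contra S0 => /eqP y0; rewrite SE' y0 scale0r.
exists (y / c); first by rewrite mulf_neq0 // invr_neq0.
by rewrite SE' XiE scalerA divfK.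
Qed.

Lemma conicZ_points (P : 'rV[int]_3) : conicZ Phi P ->
  exists s t : int, [/\ coprimez s t,
    t = 0 \/ exists q : rat, s = numq q /\ t = denq q &
    P = std_point n s t *m M \/ P = - (std_point n s t *m M)].
Proof.
move=> cP; have [v cv ->] := reduces_pull rM cP.
have [s [t [cst tq vE]]] := conicZ_std_inv n0 cv.
exists s, t; split=> //.
by case: vE => ->; [left | right; rewrite mulNmx].
Qed.

(** The primitive vector proportional to v M is an isotropic vector of Phi, hence
lies in the sublattice spanned by M; its coordinates are then v divided by the
content of v M, so this content divides that of v. *)
Lemma conicZ_push (v : 'rV[int]_3) : conicZ (adapted 1 0 0 n) v ->
  conicZ Phi (v *m M).
Proof.
move=> cv; have [m0 d0 hq hP] := rM; have [pv qv] := cv.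
have qP : qval Phi (v *m M) = 0 by rewrite -[M]map_intr_mx hq qv mulr0.
have injM (u w : 'rV[int]_3) : u *m M = w *m M -> u = w.
  move=> /(congr1 (mulmx^~ (\adj M))); rewrite -!mulmxA mul_mx_adj.
  by rewrite !mul_mx_scalar => /(scale_row_inj d0).
have v0 : v *m M != 0.
  apply/eqP => vM0; have v0 : v = 0 by apply: injM; rewrite vM0 mul0mx.
  by move: pv; rewrite v0 big1 // => i _; rewrite mxE.
have [g [w [g0 pw vE]]] := primitive_part v0.
have [|v' v'E] := hP w.
  split=> //; apply/eqP; move/eqP: qP.
  by rewrite vE qvalZ mulf_eq0 expf_eq0 /= gt_eqF.
have vgE : v = g *: v' by apply: injM; rewrite vE v'E scalemxAl.
have g1 : g = 1.
  have /eqP := contentZ g v'; rewrite -vgE pv eq_sym muln_eq1 => /andP[/eqP g1 _].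
  by rewrite -(gtr0_norm g0) -abszE g1.
by split=> //; rewrite vE g1 scale1r.
Qed.

Lemma coprime_neq0 (s t : int) : coprimez s t -> (s, t) != (0, 0).
Proof. by move=> cst; apply/eqP => -[s0 t0]; move: cst; rewrite s0 t0. Qed.

(** With 2 z = (xi + xi') y the second factor in the ratio becomes
|y| |s - t xi'|, and |y| cancels against 2 |z - xi y| = |y| |xi - xi'|. *)
Lemma mu_conicE (Xi Xi' Sigma : 'rV[R]_3) (c c' xi xi' : R) : c != 0 -> c' != 0 ->
  Xi = c *: (affine_curve n xi *m MR) -> Xi' = c' *: (affine_curve n xi' *m MR) ->
  (forall q : rat, xi != ratr q) -> (forall q : rat, xi' != ratr q) ->
  ~ proj_eq Xi Xi' -> on_tangent Phi Xi Sigma -> on_tangent Phi Xi' Sigma ->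
  mu_conic Phi Sigma = (m%:~R%:E * mu_gcd n xi xi')%E.
Proof.
move=> c0 c'0 XiE XiE' irr irr' np tS tS'; have [m0 _ _ _] := rM.
have mR : 0 < m%:~R :> R by rewrite ltr0z.
have nR : n%:~R != 0 :> R by rewrite intr_eq0 gt_eqF.
have xi_neq : xi - xi' != 0.
  rewrite subr_eq0; apply/eqP => xx; apply: np.
  exists (c / c'); first by rewrite mulf_neq0 ?invr_neq0.
  by rewrite XiE XiE' xx scalerA divfK.
have [y [z SE]] := tangent_coordinates c0 XiE tS.
have [y' [z' SE']] := tangent_coordinates c'0 XiE' tS'.
(* Sigma is the pole of the chord: the two tangent equations determine it up to
   scaling. *)
have zE : 2 * z = (xi + xi') * y.
  move: SE'; rewrite SE => /(can_inj (mulmxK uMR)) /rowP h.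
  have := h 0; have := h 1; have := h 2; rewrite !mxE /= => <- <- hx.
  apply: (mulfI xi_neq); apply: (mulfI nR); lra.
have y0 : y != 0.
  apply: contra tS.1 => /eqP y0; have z0 : z = 0 by move: zE; rewrite y0; lra.
  rewrite SE y0 z0 !mulr0 subr0 (_ : row3 _ _ _ = 0) ?mul0mx //.
  by apply/eqP; rewrite row3_eq0 eqxx.
pose term (s t : int) : R := `|xi - xi'| * (gcdz t n)%:~R /
  (`|s%:~R - t%:~R * xi| * `|s%:~R - t%:~R * xi'|).
have termE (s t : int) : (s, t) != (0, 0) ->
    ((`|xi - xi'| * (gcdz t n)%:~R)%:E /
     (`|s%:~R - t%:~R * xi| * `|s%:~R - t%:~R * xi'|)%:E)%E = (term s t)%:E.
  by move=> st; rewrite EFin_div // mulf_neq0 // normr_eq0 irrational_sub_neq0.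
have ratioE (s t : int) : (s, t) != (0, 0) ->
    conic_ratio Phi Sigma (std_point n s t *m M) = (m%:~R * term s t)%:E.
  move=> st; have a0 := irrational_sub_neq0 irr st.
  have b0 := irrational_sub_neq0 irr' st.
  have bE : y * (s%:~R + t%:~R * xi) - 2 * z * t%:~R = y * (s%:~R - t%:~R * xi').
    by rewrite zE; ring.
  rewrite SE (conic_ratio_std n0 rM) //; last by rewrite bE mulf_neq0.
  have -> : 2 * `|z - xi * y| = `|y| * `|xi - xi'|.
    rewrite -[2]ger0_norm // -!normrM mulrBr zE distrC; congr `|_|; ring.
  rewrite bE normrM /term; congr EFin; field.
  by rewrite !normr_eq0 a0 b0 y0.
apply/eqP; rewrite eq_le; apply/andP; split.
  apply: ge_ereal_sup => _ [P cP <-]; have [s [t [cst _ PE]]] := conicZ_points cP.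
  have st := coprime_neq0 cst.
  have -> : conic_ratio Phi Sigma P = (m%:~R * term s t)%:E.
    by rewrite -ratioE //; case: PE => ->; rewrite ?conic_ratioN.
  rewrite EFinM lee_pmul2l ?lte_fin // -termE //.
  by apply: ereal_sup_ubound; exists (s, t).
rewrite -lee_pdivlMl //; apply: ge_ereal_sup => _ [[s t] /= st <-].
rewrite lee_pdivlMl // termE // -EFinM.
(* Dividing (s, t) by its gcd g divides the denominator by g^2 and the gcd with n
   by at most g, so coprime pairs suffice. *)
have [g [s' [t' [g0 sE tE cst']]]] : exists g s' t' : int,
    [/\ 0 < g, s = s' * g, t = t' * g & coprimez s' t'].
  have /dvdzP[s' sE] : (gcdz s t %| s)%Z by exact: dvdz_gcdl.
  have /dvdzP[t' tE] : (gcdz s t %| t)%Z by exact: dvdz_gcdr.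
  have g0 : 0 < gcdz s t by rewrite lt_def gcdz_eq0 -xpair_eqE st.
  exists (gcdz s t), s', t'; split=> //.
  apply/eqP/(mulIf (lt0r_neq0 g0)); rewrite mul1r.
  by rewrite -[X in _ * X = _]gtr0_norm // mulz_gcdl -sE -tE.
have st' := coprime_neq0 cst'.
apply: le_trans (ereal_sup_ubound _); last first.
  exists (std_point n s' t' *m M); last reflexivity.
  by apply: conicZ_push; exact: conicZ_std_point.
rewrite ratioE // lee_fin ler_pM2l // /term.
have a0 := irrational_sub_neq0 irr st'; have b0 := irrational_sub_neq0 irr' st'.
have gR : 1 <= g%:~R :> R by rewrite ler1z -gtz0_ge1.
have lE (x : R) : (s' * g)%:~R - (t' * g)%:~R * x = g%:~R * (s'%:~R - t'%:~R * x).
  by rewrite !intrM; ring.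
have gR0 : 0 < g%:~R :> R by rewrite ltr0z.
rewrite sE tE !lE !normrM !(gtr0_norm gR0) mulrACA invfM mulrA.
rewrite ler_pM2r ?invr_gt0 ?mulr_gt0 ?normr_gt0 //.
rewrite ler_pdivrMr ?mulr_gt0 // -mulrA ler_wpM2l //.
(* The left side divides gcd(t' g, n g). *)
have le1 : gcdz (t' * g) n <= gcdz t' n * g.
  rewrite -[X in _ <= _ * X]gtr0_norm // mulz_gcdl lez_nat dvdn_leq //.
    by rewrite -[(0 < _)%N]/(0 < gcdz (t' * g) (n * g)) gcdz_gt0 // mulr_gt0.
  by rewrite dvdn_gcd dvdn_gcdl [X in (_ %| X)%N]abszM dvdn_mulr // dvdn_gcdr.
apply: le_trans (_ : (gcdz t' n * g)%:~R <= _); first by rewrite ler_int.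
rewrite intrM ler_wpM2l ?ler0z // ler_pMr //.
Qed.

(** The coordinate Z / Y is continuous at a point with nonzero Y and invariant
under scaling, so it transfers neighbourhoods from the line to the conic. *)
Lemma nbhs_coordinate (Xi : 'rV[R]_3) (c xi : R) (U : set R) : c != 0 ->
  Xi = c *: (affine_curve n xi *m MR) -> nbhs xi U ->
  nbhs Xi [set u : 'rV[R]_3 | let w := u *m invmx MR in w 0 1 != 0 /\ U (w 0 2 / w 0 1)].
Proof.
move=> c0 XiE nU.
have wE : Xi *m invmx MR = c *: affine_curve n xi by rewrite XiE scalemxAl mulmxK.
have w1 : (Xi *m invmx MR) 0 1 = c by rewrite wE !mxE mulr1.
have w2 : (Xi *m invmx MR) 0 2 = c * xi by rewrite wE !mxE.
have cont j : (fun u : 'rV[R]_3 => (u *m invmx MR) 0 j) @ nbhs Xi --> (Xi *m invmx MR) 0 j.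
  under eq_fun do rewrite mxE.
  rewrite mxE; apply: cvg_big => [|k _]; first exact: add_continuous.
  by apply: cvgM; [exact: coord_continuous | exact: cvg_cst].
have c1 := cont 1; have c2 := cont 2; rewrite w1 in c1; rewrite w2 in c2.
have cq : (fun u : 'rV[R]_3 => (u *m invmx MR) 0 2 / (u *m invmx MR) 0 1) @ nbhs Xi --> xi.
  rewrite (_ : xi = c * xi / c); last by rewrite mulrAC mulfV // mul1r.
  by apply: cvgM => //; apply: cvgV.
apply: filterI; last exact: cq.
exact: (cvgr_neq0 _ c1 c0).
Qed.

(** Keeping c fixed, the representatives c (n x^2, 1, x) of the points of the curve
tend to the given representative, as neighbourhoods of a projective point ask. *)
Lemma nbhs_curve (c xi : R) (V : set 'rV[R]_3) :
  nbhs (c *: (affine_curve n xi *m MR)) V ->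
  nbhs xi [set x | V (c *: (affine_curve n x *m MR))].
Proof.
have E x : c *: (affine_curve n x *m MR) = (x ^+ 2) *: ((c * n%:~R) *: (row3 1 0 0 *m MR)) +
    (c *: (row3 0 1 0 *m MR) + x *: (c *: (row3 0 0 1 *m MR))).
  rewrite !scalerA !scalemxAl -!mulmxDl !row3Z !row3D.
  by congr (row3 _ _ _ *m _); ring.
move=> nV.
have cc : (fun x : R => c *: (affine_curve n x *m MR)) @ nbhs xi -->
    c *: (affine_curve n xi *m MR).
  rewrite E; under eq_fun do rewrite E.
  apply: cvgD; first by apply: cvgZr_tmp; exact: exprn_continuous.
  by apply: cvgD; [exact: cvg_cst | apply: cvgZr_tmp; exact: cvg_id].
exact: cc.
Qed.

Lemma conicZ_nbhs_basic (Xi : 'rV[R]_3) (V : set 'rV[R]_3) : nbhs Xi V ->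
  conicZ_nbhs Phi Xi [set P : 'rV[int]_3 | conicZ Phi P /\
    exists2 k : R, k != 0 & V (k *: map_mx intr P)].
Proof. by move=> nV; exists V. Qed.

Lemma rat_nbhs_basic (xi : R) (U : set R) : nbhs xi U ->
  rat_nbhs xi [set q : rat | U (ratr q)].
Proof. by move=> nU; exists U. Qed.

(** Writing q = s/t, the ratio at the point of parameter q is m times the term of
lambda_gcd times C / B q, where C = 2 |z - xi y| and B q = |y (q + xi) - 2 z|
tends to C as q tends to xi. Both inequalities follow up to a factor 1 + e. *)
Lemma lambda_conicE (Xi Sigma : 'rV[R]_3) (c xi : R) : c != 0 ->
  Xi = c *: (affine_curve n xi *m MR) -> (forall q : rat, xi != ratr q) ->
  on_tangent Phi Xi Sigma -> ~ proj_eq Sigma Xi ->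
  lambda_conic Phi Xi Sigma = (m%:~R%:E * lambda_gcd n xi)%E.
Proof.
move=> c0 XiE irr tS np; have [m0 _ _ _] := rM.
have mR : 0 < m%:~R :> R by rewrite ltr0z.
have [y [z SE]] := tangent_coordinates c0 XiE tS.
have C0 := tangent_nondegenerate c0 XiE tS.1 SE np.
pose C : R := 2 * `|z - xi * y|; pose B (x : R) : R := `|y * (x + xi) - 2 * z|.
have Cgt0 : 0 < C by rewrite mulr_gt0 // normr_gt0.
have BE : B xi = C.
  by rewrite /B /C -[X in X * `|_|]ger0_norm // -normrM distrC; congr `|_|; ring.
have Bcont : B @ nbhs xi --> C.
  rewrite -BE; apply: cvg_norm; apply: cvgB; last exact: cvg_cst.
  apply: cvgM; first exact: cvg_cst.
  by apply: cvgD; [exact: cvg_id | exact: cvg_cst].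
pose term (q : rat) : R := (gcdz (denq q) n)%:~R / ((denq q)%:~R ^+ 2 * `|ratr q - xi|).
have termE (q : rat) : ((gcdz (denq q) n)%:~R%:E /
    ((denq q)%:~R ^+ 2 * `|ratr q - xi|)%:E)%E = (term q)%:E.
  exact: lambda_term.
have term_ge0 q : 0 <= term q.
  by rewrite divr_ge0 ?ler0z ?mulr_ge0 ?exprn_ge0 ?ler0z ?denq_ge0.
have ratioE (q : rat) : B (ratr q) != 0 ->
    conic_ratio Phi Sigma (std_point n (numq q) (denq q) *m M) =
    (m%:~R * term q * (C / B (ratr q)))%:E.
  move=> Bq; set s := numq q; set t := denq q.
  have tR : t%:~R != 0 :> R by rewrite intr_eq0 denq_neq0.
  have sE : s%:~R = ratr q * t%:~R :> R.
    by rewrite /s -[LHS]ratr_int numqE rmorphM /= ratr_int.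
  have aE : s%:~R - t%:~R * xi = t%:~R * (ratr q - xi) by rewrite sE; ring.
  have bE : y * (s%:~R + t%:~R * xi) - 2 * z * t%:~R = t%:~R * (y * (ratr q + xi) - 2 * z).
    by rewrite sE; ring.
  have q0 : ratr q - xi != 0 by rewrite subr_eq0 eq_sym.
  rewrite SE (conic_ratio_std n0 rM) ?aE ?bE ?mulf_neq0 //; last by rewrite -normr_eq0.
  rewrite !normrM -/(B (ratr q)) -/C /term -/t (gtr0_norm (_ : 0 < t%:~R)) ?ltr0z ?denq_gt0 //.
  by congr EFin; field; rewrite Bq tR normr_eq0 q0.
(* The factor C / B x is within 1 + e of 1 in both directions near xi. *)
have Bnear (e : R) : 0 < e ->
    nbhs xi [set x | 0 < B x /\ C <= (1 + e) * B x /\ B x <= (1 + e) * C].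
  move=> e0; have e1 : 0 < 1 + e by rewrite addr_gt0.
  have h1 : C / (1 + e) < C by rewrite ltr_pdivrMr // ltr_pMr // ltrDl.
  have h2 : C < (1 + e) * C by rewrite mulrC ltr_pMr // ltrDl.
  have g1 : \forall x \near xi, C / (1 + e) < B x by exact: cvgr_gt Bcont _ h1.
  have g2 : \forall x \near xi, B x < (1 + e) * C by exact: cvgr_lt Bcont _ h2.
  apply: filterS (filterI g1 g2) => x [/= x1 x2]; split.
    by apply: lt_trans x1; rewrite divr_gt0.
  by split; [rewrite mulrC -ler_pdivrMr // ltW | exact: ltW].
apply/eqP; rewrite eq_le; apply/andP; split.
  apply: lee_mul1p => e e0; rewrite muleA -EFinM.
  apply: limsup_along_le; first by rewrite mulr_gt0 // addr_gt0.
  move=> V [U nU hU].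
  have nUB : nbhs xi (U `&` [set x | 0 < B x /\ C <= (1 + e) * B x /\ B x <= (1 + e) * C]).
    exact: filterI nU (Bnear e e0).
  have nW := nbhs_coordinate c0 XiE nUB.
  eexists; first exact: conicZ_nbhs_basic nW.
  move=> P [cP [k k0 [/= w1 [Uw Bw]]]].
  have [s [t [cst tq PE]]] := conicZ_points cP.
  (* Up to a nonzero scalar, the coordinates of P are (n s^2, t^2, s t), whatever
     the sign of P and the scalar k of the neighbourhood. *)
  have [eps [eps0 PN]] : exists eps : R, eps != 0 /\
      k *: map_mx intr P *m invmx MR =
      eps *: row3 (n%:~R * s%:~R ^+ 2) (t%:~R ^+ 2) (s%:~R * t%:~R).
    have gR : (gcdz t n)%:~R != 0 :> R by rewrite intr_eq0 gt_eqF // gcdz_gt0.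
    exists ((if P == std_point n s t *m M then k else - k) / (gcdz t n)%:~R).
    split; first by rewrite mulf_neq0 ?invr_neq0 //; case: ifP; rewrite ?oppr_eq0.
    rewrite -scalerA -map_std_point //; case: PE => PE.
      by rewrite PE eqxx map_mxM -scalemxAl mulmxK.
    case: ifP => [/eqP ->|_]; first by rewrite map_mxM -scalemxAl mulmxK.
    by rewrite PE map_mxN map_mxM scalerN -scaleNr -scalemxAl mulmxK.
  rewrite PN !mxE /= in w1 Uw Bw.
  have tR : t%:~R != 0 :> R.
    by apply: contra w1 => /eqP ->; rewrite expr0n mulr0.
  case: tq => [t0|[q [sE tE]]]; first by rewrite t0 eqxx in tR.
  have qE : eps * (s%:~R * t%:~R) / (eps * t%:~R ^+ 2) = ratr q.
    rewrite -[q]divq_num_den -sE -tE rmorphM fmorphV /= !ratr_int; field.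
    by rewrite tR eps0.
  rewrite qE in Uw Bw; exists q; first exact: hU.
  have [B0 [B1 B2]] := Bw.
  have -> : conic_ratio Phi Sigma P = (m%:~R * term q * (C / B (ratr q)))%:E.
    by rewrite -ratioE ?gt_eqF // -sE -tE; case: PE => ->; rewrite ?conic_ratioN.
  rewrite termE -EFinM lee_fin [leRHS](_ : _ = m%:~R * term q * (1 + e)).
    by apply: ler_wpM2l; [rewrite mulr_ge0 // ltW | rewrite ler_pdivrMr].
  by ring.
rewrite -lee_pdivlMl //; apply: lee_mul1p => e e0; rewrite muleA -EFinM.
apply: limsup_along_le; first by rewrite mulr_gt0 ?invr_gt0 // addr_gt0.
move=> W [V nV hV]; rewrite XiE in nV.
have nU : nbhs xi ([set x | V (c *: (affine_curve n x *m MR))] `&`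
    [set x | 0 < B x /\ C <= (1 + e) * B x /\ B x <= (1 + e) * C]).
  exact: filterI (nbhs_curve nV) (Bnear e e0).
eexists; first exact: rat_nbhs_basic nU.
move=> q [/= Vq [B0 [B1 B2]]].
have tR : (denq q)%:~R != 0 :> R by rewrite intr_eq0 denq_neq0.
have gR : (gcdz (denq q) n)%:~R != 0 :> R by rewrite intr_eq0 gt_eqF // gcdz_gt0.
exists (std_point n (numq q) (denq q) *m M).
  apply: hV; split.
    apply/conicZ_push/conicZ_std_point => //.
    by rewrite /coprimez /gcdz; exact: coprime_num_den.
  exists (c * ((gcdz (denq q) n)%:~R / (denq q)%:~R ^+ 2)).
    by rewrite !mulf_neq0 // invr_neq0 // expf_neq0.
  rewrite map_mxM map_std_point // -scalemxAl scalerA.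
  rewrite [X in X *: _](_ : _ = c * ((denq q)%:~R ^+ 2)^-1); last first.
    by field; rewrite tR gR.
  rewrite -scalerA.
  move: Vq; congr (V (c *: _)); rewrite scalemxAl row3Z; congr (row3 _ _ _ *m _).
  - by rewrite -[q in LHS]divq_num_den rmorphM fmorphV /= !ratr_int; field.
  - by rewrite mulVf // expf_neq0.
  - by rewrite -[q in LHS]divq_num_den rmorphM fmorphV /= !ratr_int; field.
rewrite ratioE ?gt_eqF // termE -EFinM lee_fin.
rewrite [leRHS](_ : _ = term q * ((1 + e) * C / B (ratr q))); last first.
  have := lt0r_neq0 B0; have := lt0r_neq0 mR.
  by move: (term q) (B _) => T b mN bN; field; rewrite ?mN ?bN.
by rewrite ler_peMr // ler_pdivlMr // mul1r.
Qed.
End approximation.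

(** * Approximability on an isotropic conic over the rational numbers *)

Theorem theorem1p4 (R : realType) (Phi : tqf)
    (Phi_iso : isotropic Phi) (disc_gt0 : 0 < disc rat Phi) :
  exists (n m : int) (f : 'rV[R[i]]_3 -> 'rV[R[i]]_2),
    [/\ exists k : int, disc rat Phi = (k * (n * m ^+ 2))%:~R,
        parametrization Phi f,
        forall (Xi : 'rV[R]_3) (xi : R),
          irrational_point Phi Xi -> has_coordinate f Xi xi ->
          forall Sigma : 'rV[R]_3,
            on_tangent Phi Xi Sigma -> ~ proj_eq Sigma Xi ->
            lambda_conic Phi Xi Sigma =
              (m%:~R%:E * max_divisors n (fun d => lambda_real (d * xi)))%E /\
            lambda_conic Phi Xi Sigma = (m%:~R%:E * lambda_gcd n xi)%E &
        forall (Xi Xi' : 'rV[R]_3) (xi xi' : R),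
          irrational_point Phi Xi -> irrational_point Phi Xi' ->
          ~ proj_eq Xi Xi' ->
          has_coordinate f Xi xi -> has_coordinate f Xi' xi' ->
          forall Sigma : 'rV[R]_3,
            on_tangent Phi Xi Sigma -> on_tangent Phi Xi' Sigma ->
            mu_conic Phi Sigma =
              (m%:~R%:E *
               max_divisors n (fun d => mu_real (d * xi) (d * xi')))%E /\
            mu_conic Phi Sigma = (m%:~R%:E * mu_gcd n xi xi')%E].
Proof.
have [m [M [n [n0 rM]]]] := conic_reduces Phi_iso disc_gt0.
exists n, m, (@to_line M R[i]); split.
- exists (m * `|\det M|).
  by rewrite (reduces_disc rat rM) disc_adapted -intrM; congr (_%:~R); ring.
- exact: (to_line_parametrization n0 rM).
- move=> Xi xi [[Xi0 cXi] irrXi] hXi Sigma tS np.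
  have [c c0 XiE] := to_line_coordinate rM cXi hXi.
  have irr := irrational_coordinate rM c0 XiE irrXi.
  rewrite -lambda_gcd_max //; split; exact: (lambda_conicE n0 rM c0 XiE irr tS np).
- move=> Xi Xi' xi xi' [[_ cXi] irrXi] [[_ cXi'] irrXi'] np hXi hXi' Sigma tS tS'.
  have [c c0 XiE] := to_line_coordinate rM cXi hXi.
  have [c' c'0 XiE'] := to_line_coordinate rM cXi' hXi'.
  have irr := irrational_coordinate rM c0 XiE irrXi.
  have irr' := irrational_coordinate rM c'0 XiE' irrXi'.
  rewrite -mu_gcd_max //.
  by split; exact: (mu_conicE n0 rM c0 c'0 XiE XiE' irr irr' np tS tS').
Qed.
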